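(* Let $\mathsf{c}>c_0$ and let $k_0$ be the unique integer such that $c_{k_0}<\mathsf{c}<\tilde c_{k_0}$ or $\tilde c_{k_0}\le\mathsf{c}<c_{k_0+1}$ (one has $k_0=\left[\frac{4}{3\pi}\mathsf{c}^{3/2}\right]$ or $k_0=\left[\frac{4}{3\pi}\mathsf{c}^{3/2}\right]-1$). (1) The $k_0+1$ first rescaled spectral bands $[\mathbf{E}_{\mathrm{min}}^p,\mathbf{E}_{\mathrm{max}}^p]$, $0\le p\le k_0$, are included in $[-\mathsf{c},0]$. (2) For every $p\in\{2,\ldots,k_0\}$, $$0<\delta_p\le\left(\frac{\pi}{3}+\frac{7}{3\pi}\frac{p+\frac13}{p(p+\frac23)}\right)\left(\frac3\pi\right)^{1/3}\frac1{p^{1/3}},$$ and for every $p\in\{2,\ldots,k_0-1\}$, $$0<I\left(\left(\tfrac76\right)^{2/3}\right)\frac{2^{1/3}\pi^{2/3}}{9}\frac1{(p+1)^{1/3}}<\gamma_p\le\left(\pi+\frac{7}{3\pi}\frac{p}{p^2-1}\right)\left(\frac3\pi\right)^{1/3}\frac1{(p-1)^{1/3}}.$$ In particular, all the spectral gaps of $\sigma(H)$ in $[-V_0,0]$ are open (i.e. non-empty).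
   Context: Let $\hbar,m,L_0,V_0>0$. Let $V$ be the $2L_0$-periodic function on $\mathbb{R}$ with $V(x)=V_0(|x|/L_0-1)$ for $x\in[-L_0,L_0]$, and $H=-\frac{\hbar^2}{2m}\frac{d^2}{dx^2}+V$ acting on the Sobolev space $H^2(\mathbb{R})$. Its spectrum is $\sigma(H)=\bigcup_{p\ge 0}[E_{\mathrm{min}}^p,E_{\mathrm{max}}^p]$, where $E_{\mathrm{min}}^0\le E_{\mathrm{max}}^1\le E_{\mathrm{min}}^2\le\dots$ are the eigenvalues of $-\frac{\hbar^2}{2m}\frac{d^2}{dx^2}+V$ on $[-L_0,L_0]$ with periodic boundary conditions, and $E_{\mathrm{max}}^0\le E_{\mathrm{min}}^1\le E_{\mathrm{max}}^2\le\dots$ those with antiperiodic boundary conditions. The spectral gaps are the intervals $(E_{\mathrm{max}}^p,E_{\mathrm{min}}^{p+1})$. Set $\theta=\left(\frac{2mL_0^2}{\hbar^2V_0^2}\right)^{1/3}$, $\mathsf{c}=\theta V_0$, $\mathbf{E}_{\mathrm{min}}^p=\theta E_{\mathrm{min}}^p$, $\mathbf{E}_{\mathrm{max}}^p=\theta E_{\mathrm{max}}^p$, $\delta_p=\mathbf{E}_{\mathrm{max}}^p-\mathbf{E}_{\mathrm{min}}^p$, $\gamma_p=\mathbf{E}_{\mathrm{min}}^{p+1}-\mathbf{E}_{\mathrm{max}}^p$; these rescaled quantities depend only on $\mathsf{c}$. Let $u,v$ be the solutions of the Airy equation $y''=xy$ with $u(0)=1,u'(0)=0$ and $v(0)=0,v'(0)=1$.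 Arranged in decreasing order: the zeroes of $v'$ are $-c_{2j}$, $j\ge0$; the nonzero zeroes of $v$ are $-c_{2j+1}$, $j\ge0$; the zeroes of $u$ are $-\tilde c_{2j}$, $j\ge0$; the nonzero zeroes of $u'$ are $-\tilde c_{2j+1}$, $j\ge0$ (all negative). One has $c_p<\tilde c_p<c_{p+1}$ for all $p\ge 0$. $[x]$ denotes the integer part of $x$. The function $I$ is defined on $[1,+\infty)$ by $I(y)=\left(\frac32\right)^{1/3}\frac{y^{3/2}+1}{y^2+y+1}$. *)

(* Defs.v *)
From Stdlib Require Export Reals List.
From Coquelicot Require Export Coquelicot.
Open Scope R_scope.

(** * The Airy equation *)

Definition airy_solution (y : R -> R) (y0 y1 : R) : Prop :=
  (forall x, ex_derive y x /\ ex_derive (Derive y) x /\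
             Derive_n y 2 x = x * y x) /\
  y 0 = y0 /\ Derive y 0 = y1.

Definition enumerates_decreasing (a : nat -> R) (Z : R -> Prop) : Prop :=
  (forall j, a (S j) < a j) /\ (forall x, Z x <-> exists j, a j = x).

(** * The potential *)

Definition periodic_potential (L0 V0 : R) (V : R -> R) : Prop :=
  (forall x, V (x + 2 * L0) = V x) /\
  (forall x, - L0 <= x <= L0 -> V x = V0 * (Rabs x / L0 - 1)).

(** * Eigenvalue problems on [[-L0, L0]] *)

(** [s = 1] gives the periodic and [s = -1] the antiperiodic boundary
    conditions.  A function on [[-L0, L0]] is represented by a twice
    differentiable function on [R]; its values outside [[-L0, L0]] are
    irrelevant, and [is_basis] below identifies functions that agree on
    [[-L0, L0]].  Since [V] is continuous, every eigenfunction in the Sobolev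
    sense is of this form.  The zero function belongs to every eigenspace. *)
Definition eigenspace (hbar m L0 : R) (V : R -> R) (s E : R)
    (psi : R -> R) : Prop :=
  (forall x, ex_derive psi x /\ ex_derive (Derive psi) x) /\
  (forall x, - L0 <= x <= L0 ->
     - (hbar ^ 2 / (2 * m)) * Derive_n psi 2 x + V x * psi x = E * psi x) /\
  psi L0 = s * psi (- L0) /\
  Derive psi L0 = s * Derive psi (- L0).

Definition lincomb (a : list R) (f : list (R -> R)) (x : R) : R :=
  fold_right Rplus 0 (map (fun af => fst af * snd af x) (combine a f)).

Definition is_basis (L0 : R) (W : (R -> R) -> Prop)
    (f : list (R -> R)) : Prop :=
  (forall g, In g f -> W g) /\
  (forall a, length a = length f ->
     (forall x, - L0 <= x <= L0 -> lincomb a f x = 0) ->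
     forall t, In t a -> t = 0) /\
  (forall g, W g -> exists a, length a = length f /\
     forall x, - L0 <= x <= L0 -> g x = lincomb a f x).

(** [e] lists the eigenvalues in nondecreasing order, each repeated according
    to its multiplicity: every real [E] occurs in [e] exactly as many times as
    the dimension of its eigenspace (zero times if [E] is not an eigenvalue). *)
Definition eigenvalue_sequence (hbar m L0 : R) (V : R -> R) (s : R)
    (e : nat -> R) : Prop :=
  (forall n, e n <= e (S n)) /\
  (forall E, exists (f : list (R -> R)) (l : list nat),
     is_basis L0 (eigenspace hbar m L0 V s E) f /\
     NoDup l /\ (forall n, In n l <-> e n = E) /\ length l = length f).

(** The band [p] is [[Emin p, Emax p]].  The periodic eigenvalues are
    [Emin 0 <= Emax 1 <= Emin 2 <= ...], the antiperiodic ones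
    [Emax 0 <= Emin 1 <= Emax 2 <= ...]. *)
Definition band_edges (hbar m L0 : R) (V : R -> R)
    (Emin Emax : nat -> R) : Prop :=
  eigenvalue_sequence hbar m L0 V 1
    (fun p => if Nat.even p then Emin p else Emax p) /\
  eigenvalue_sequence hbar m L0 V (-1)
    (fun p => if Nat.even p then Emax p else Emin p).

Definition spectral_gap (Emin Emax : nat -> R) (p : nat) (E : R) : Prop :=
  Emax p < E < Emin (S p).

Definition theta (hbar m L0 V0 : R) : R :=
  Rpower (2 * m * L0 ^ 2 / (hbar ^ 2 * V0 ^ 2)) (1 / 3).

Definition band_width (th : R) (Emin Emax : nat -> R) (p : nat) : R :=
  th * Emax p - th * Emin p.

Definition gap_width (th : R) (Emin Emax : nat -> R) (p : nat) : R :=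
  th * Emin (S p) - th * Emax p.

Definition position (c ct : nat -> R) (cc : R) (k : nat) : Prop :=
  (c k < cc < ct k) \/ (ct k <= cc < c (S k)).

(** Only meant for [1 <= y]. *)
Definition I_fun (y : R) : R :=
  Rpower (3 / 2) (1 / 3) * ((Rpower y (3 / 2) + 1) / (y ^ 2 + y + 1)).

(* Main.v *)
Require Import Defs.
From Stdlib Require Import Lra Lia Psatz Arith ZArith Machin.

(** Put [a = cc + th E] and [xi = k x - a] with [k = cc / L0].  On [[0, L0]] the
    eigenvalue equation becomes the Airy equation on [[- a, cc - a]].  As the
    potential is even, the boundary problem splits by parity: an even
    eigenfunction has slope zero at [xi = - a], an odd one vanishes there, and
    at [xi = cc - a] the slope or the value vanishes, depending on the parity
    and on the boundary sign ([eigen_even], [eigen_odd], [eigen_exists]).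

    For [0 < a < cc] the right end is positive.  There [u], [v] and their
    derivatives are positive, and [v / u < v' / u'], the first ratio increasing
    and the second one decreasing.  The right condition prescribes one of
    these ratios as the value of [v' / u'] (even) or [v / u] (odd) at [- a],
    which must thus be positive; this confines [a] to the intervals
    [(ct (p - 1), c p)], with [p] of the same parity.  In each of them the left
    ratio falls from infinity to zero, and there is exactly one Neumann point,
    followed by exactly one Dirichlet point ([band_points]).  The simplicity of
    all these eigenvalues makes the enumeration with multiplicity follow the
    intervals ([nth_eigenvalue]), so band [p] lies in [(ct (p - 1), c p)] after
    the shift by [cc].  Consequently
    [delta p < c p - ct (p - 1)] and
    [ct p - c p < gamma p < c (p + 1) - ct (p - 1)].
    A closed gap would be a double eigenvalue, with an even and an odd
    eigenfunction, and the sign pattern excludes this ([gap_open]).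

    It remains to locate the zeroes.  In the variable [w = sqrt (- x)] the
    suitably scaled Pruefer angles of [u] and [v] differ from [2 / 3 * w ^ 3] by
    a quantity that is controlled for all larger [w] by its value at one point
    ([phase_bounds]).  Taylor polynomials with error bounds give this value at
    [w = 6 / 5].  A zero of index [p] is the point where its angle reaches
    [(p + 1) PI / 2] or [(p + 2) PI / 2], so [2 / 3 * c p ^ (3/2)] and
    [2 / 3 * ct p ^ (3/2)] are known up to small constants
    ([zeros_location]).  These constants already imply all the inequalities,
    including the position of [cc ^ (3/2)]. *)

(** After [auto_derive], replaces the derivatives of an abstract function by
    the value that [H] gives for them. *)
Ltac use_derive H :=
  match type of H with
  | forall x, is_derive ?f x _ =>
      repeat match goal with
      | |- context [Derive (fun x => f x) ?t] =>
          let E := fresh in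
          assert (E := is_derive_unique f t _ (H t));
          change (Derive f t) with (Derive (fun x : R => f x) t) in E;
          rewrite E; clear E
      end
  end.

(** * Calculus on an interval *)
Lemma mean_value f f' a b :
  a < b -> (forall t, a <= t <= b -> is_derive f t (f' t)) ->
  exists t, a < t < b /\ f b - f a = f' t * (b - a).
Proof.
intros hab hd.
destruct (MVT_cor2 f f' a b hab) as [t [h1 h2]].
- intros t ht; apply is_derive_Reals; auto.
- exists t; auto.
Qed.

Lemma derive_nonneg_le f f' a b :
  a <= b -> (forall t, a <= t <= b -> is_derive f t (f' t)) ->
  (forall t, a < t < b -> 0 <= f' t) -> f a <= f b.
Proof.
intros hab hd hp; destruct (Rle_lt_or_eq_dec _ _ hab) as [h | ->]; [ | lra].
destruct (mean_value f f' a b h hd) as [t [ht e]].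
specialize (hp t ht); nra.
Qed.

Lemma derive_pos_lt f f' a b :
  a < b -> (forall t, a <= t <= b -> is_derive f t (f' t)) ->
  (forall t, a < t < b -> 0 < f' t) -> f a < f b.
Proof.
intros h hd hp.
destruct (mean_value f f' a b h hd) as [t [ht e]].
specialize (hp t ht); nra.
Qed.

Lemma derive_zero_eq f a b :
  (forall t, is_derive f t 0) -> f a = f b.
Proof.
intros hd.
destruct (Rtotal_order a b) as [h | [-> | h]]; auto.
- destruct (mean_value f (fun _ => 0) a b h) as [t [ht e]]; auto; lra.
- destruct (mean_value f (fun _ => 0) b a h) as [t [ht e]]; auto; lra.
Qed.

Lemma is_derive_continuity_pt f x l : is_derive f x l -> continuity_pt f x.
Proof.
intros h; apply derivable_continuous_pt; exists l; now apply is_derive_Reals.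
Qed.

Lemma intermediate_zero f a b :
  a <= b -> (forall t, a <= t <= b -> continuity_pt f t) ->
  f a * f b <= 0 -> exists t, a <= t <= b /\ f t = 0.
Proof.
intros hab hc hs.
destruct (Rle_lt_or_eq_dec _ _ hab) as [h | ->].
2:{ exists b; split; [lra | nra]. }
destruct (Req_dec (f a) 0) as [e | na]; [exists a; split; [lra | auto] |].
destruct (Req_dec (f b) 0) as [e | nb]; [exists b; split; [lra | auto] |].
assert (hs' : f a * f b < 0) by (assert (f a * f b <> 0) by nra; lra).
destruct (Rtotal_order (f a) 0) as [ha | [ha | ha]]; [ | lra | ].
- destruct (Ranalysis5.IVT_interv f a b hc h ha) as [t [ht e]]; [nra | exists t; auto].
- destruct (Ranalysis5.IVT_interv (fun x => - f x) a b) as [t [ht e]]; auto.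
  + intros t ht; apply continuity_pt_opp; auto.
  + lra.
  + nra.
  + exists t; split; auto; lra.
Qed.

Lemma nonzero_same_sign f a b :
  a <= b -> (forall t, a <= t <= b -> continuity_pt f t) ->
  (forall t, a <= t <= b -> f t <> 0) -> 0 < f a * f b.
Proof.
intros hab hc hn.
destruct (Rlt_le_dec 0 (f a * f b)) as [h | h]; auto.
destruct (intermediate_zero f a b hab hc h) as [t [ht e]].
now destruct (hn t ht).
Qed.

(** * The Airy equation *)
Definition airy (y y1 : R -> R) : Prop :=
  forall x, is_derive y x (y1 x) /\ is_derive y1 x (x * y x).

Lemma airy_solution_airy y y0 y1 :
  airy_solution y y0 y1 -> airy y (Derive y).
Proof.
intros [h _] x; destruct (h x) as [h1 [h2 h3]]; split.
- now apply Derive_correct.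
- simpl in h3; rewrite <- h3.
  exact (Derive_correct _ _ h2).
Qed.

Lemma airy_derive y y1 : airy y y1 -> forall x, is_derive y x (y1 x).
Proof. intros h x; apply h. Qed.
Lemma airy_derive_slope y y1 : airy y y1 -> forall x, is_derive y1 x (x * y x).
Proof. intros h x; apply h. Qed.

Lemma airy_combination u u1 v v1 p q : airy u u1 -> airy v v1 ->
  airy (fun x => p * u x - q * v x) (fun x => p * u1 x - q * v1 x).
Proof.
intros hu hv x.
pose proof (airy_derive _ _ hu) as a0; pose proof (airy_derive_slope _ _ hu) as a1.
pose proof (airy_derive _ _ hv) as b0; pose proof (airy_derive_slope _ _ hv) as b1.
split; auto_derive.
- repeat split; eexists; eauto.
- use_derive a0; use_derive b0; ring.
- repeat split; eexists; eauto.
- use_derive a1; use_derive b1; ring.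
Qed.

Lemma airy_wronskian u u1 v v1 x y : airy u u1 -> airy v v1 ->
  u x * v1 x - u1 x * v x = u y * v1 y - u1 y * v y.
Proof.
intros hu hv.
pose proof (airy_derive _ _ hu) as a0; pose proof (airy_derive_slope _ _ hu) as a1.
pose proof (airy_derive _ _ hv) as b0; pose proof (airy_derive_slope _ _ hv) as b1.
apply (derive_zero_eq (fun x => u x * v1 x - u1 x * v x)); intros t.
auto_derive.
- repeat split; eexists; eauto.
- use_derive a0; use_derive a1; use_derive b0; use_derive b1; ring.
Qed.

(** The product [y y1] has derivative [y1 ^ 2 + x y ^ 2], so it stays
    nonnegative to the right of [x0], where [y ^ 2] and [y1 ^ 2] are therefore
    nondecreasing.  Whichever of [y], [y1] is positive at [x0] cannot change
    sign, and it pulls the other one up. *)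
Lemma airy_growth y y1 x0 x : airy y y1 ->
  0 <= x0 -> 0 <= y x0 -> 0 <= y1 x0 -> (0 < y x0 \/ 0 < y1 x0) -> x0 < x ->
  0 < y x /\ 0 < y1 x.
Proof.
intros hy h0 hy0 hy1 hpos hx.
pose proof (airy_derive _ _ hy) as a0; pose proof (airy_derive_slope _ _ hy) as a1.
assert (c0 : forall t, continuity_pt y t) by (intros; eapply is_derive_continuity_pt; eauto).
assert (c1 : forall t, continuity_pt y1 t) by (intros; eapply is_derive_continuity_pt; eauto).
assert (hP : forall t, x0 <= t -> 0 <= y t * y1 t).
{ intros t ht.
  apply Rle_trans with (y x0 * y1 x0); [nra |].
  apply (derive_nonneg_le (fun t => y t * y1 t) (fun t => y1 t ^ 2 + t * y t ^ 2)); auto.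
  - intros s _; auto_derive; [repeat split; eexists; eauto | use_derive a0; use_derive a1; ring].
  - intros s hs; nra. }
assert (hy2 : forall t, x0 <= t -> y x0 ^ 2 <= y t ^ 2).
{ intros t ht.
  apply (derive_nonneg_le (fun t => y t ^ 2) (fun t => 2 * (y t * y1 t))); auto.
  - intros s _; auto_derive; [repeat split; eexists; eauto | use_derive a0; use_derive a1; ring].
  - intros s hs; specialize (hP s); nra. }
assert (hy3 : forall t, x0 <= t -> y1 x0 ^ 2 <= y1 t ^ 2).
{ intros t ht.
  apply (derive_nonneg_le (fun t => y1 t ^ 2) (fun t => 2 * (t * (y t * y1 t)))); auto.
  - intros s _; auto_derive; [repeat split; eexists; eauto | use_derive a0; use_derive a1; ring].
  - intros s hs. assert (0 <= y s * y1 s) by (apply hP; lra). nra. }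
destruct hpos as [hp | hp].
- assert (yp : forall t, x0 <= t -> 0 < y t).
  { intros t ht.
    assert (0 < y x0 * y t); [ | nra].
    apply nonzero_same_sign; auto.
    intros s hs e; assert (h : y x0 ^ 2 <= y s ^ 2) by (apply hy2; lra).
    rewrite e in h; nra. }
  split; [apply yp; lra |].
  apply Rle_lt_trans with (y1 x0); auto.
  apply (derive_pos_lt y1 (fun t => t * y t)); auto.
  intros t ht; assert (0 < y t) by (apply yp; lra); nra.
- assert (yp : forall t, x0 <= t -> 0 < y1 t).
  { intros t ht.
    assert (0 < y1 x0 * y1 t); [ | nra].
    apply nonzero_same_sign; auto.
    intros s hs e; assert (h : y1 x0 ^ 2 <= y1 s ^ 2) by (apply hy3; lra).
    rewrite e in h; nra. }
  split; [ | apply yp; lra].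
  apply Rle_lt_trans with (y x0); auto.
  apply (derive_pos_lt y y1); auto.
  intros t ht; apply yp; lra.
Qed.

(** [y1 ^ 2 - x y ^ 2] has derivative [- y ^ 2].  It could fail to decrease
    strictly only if [y] vanished on a whole interval; there [y1] would vanish
    too, and so would the quantity itself, against its positivity at [x]. *)
Lemma airy_energy_lt y y1 x x' : airy y y1 -> x < x' ->
  0 < y1 x ^ 2 - x * y x ^ 2 ->
  y1 x' ^ 2 - x' * y x' ^ 2 < y1 x ^ 2 - x * y x ^ 2.
Proof.
intros hy hx hpos.
pose proof (airy_derive _ _ hy) as a0; pose proof (airy_derive_slope _ _ hy) as a1.
set (F := fun t => y1 t ^ 2 - t * y t ^ 2).
assert (dF : forall t, is_derive F t (- y t ^ 2)).
{ intros t; unfold F; auto_derive; [repeat split; eexists; eauto | use_derive a0; use_derive a1; ring]. }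
change (0 < F x) in hpos; change (F x' < F x).
assert (mono : forall s t, s <= t -> F t <= F s).
{ intros s t hst.
  cut (- F s <= - F t); [lra |].
  apply (derive_nonneg_le (fun t => - F t) (fun t => y t ^ 2)); auto.
  - intros r _; replace (y r ^ 2) with (opp (- y r ^ 2)) by (unfold opp; simpl; ring).
    now apply (is_derive_opp F).
  - intros; nra. }
destruct (Rlt_le_dec (F x') (F x)) as [h | h]; auto; exfalso.
assert (const : forall t, x <= t <= x' -> F t = F x).
{ intros t ht; pose proof (mono x t); pose proof (mono t x'); lra. }
assert (yz : forall t, x < t < x' -> y t = 0).
{ intros t ht.
  assert (e : - y t ^ 2 = 0); [ | nra].
  rewrite <- (is_derive_unique F t _ (dF t)).
  rewrite (Derive_ext_loc F (fun _ => F x) t); [apply Derive_const |].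
  assert (hd : 0 < Rmin (t - x) (x' - t)) by (apply Rmin_glb_lt; lra).
  exists (mkposreal _ hd); intros s hs; apply const.
  unfold ball in hs; simpl in hs; unfold AbsRing_ball, abs, minus, plus, opp in hs; simpl in hs.
  apply Rabs_def2 in hs; pose proof (Rmin_l (t - x) (x' - t)); pose proof (Rmin_r (t - x) (x' - t)); lra. }
destruct (mean_value y y1 ((2 * x + x') / 3) ((x + 2 * x') / 3)) as [t [ht e]]; auto.
- lra.
- rewrite !yz in e by lra.
  assert (e1 : y1 t = 0) by nra.
  assert (e0 : y t = 0) by (apply yz; lra).
  assert (c := const t); unfold F in c at 1; rewrite e1, e0 in c; lra.
Qed.

(** * Solutions with prescribed data at the left end *)
Record fundamental (u u1 v v1 : R -> R) : Prop := {
  fund_u : airy u u1;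
  fund_v : airy v v1;
  fund_u0 : u 0 = 1;
  fund_u10 : u1 0 = 0;
  fund_v0 : v 0 = 0;
  fund_v10 : v1 0 = 1 }.

Lemma fund_wronskian u u1 v v1 x : fundamental u u1 v v1 ->
  u x * v1 x - u1 x * v x = 1.
Proof.
intros [hu hv e0 e1 f0 f1].
rewrite (airy_wronskian u u1 v v1 x 0 hu hv), e0, e1, f0, f1; ring.
Qed.

Lemma fund_pos u u1 v v1 x : fundamental u u1 v v1 -> 0 < x ->
  0 < u x /\ 0 < u1 x /\ 0 < v x /\ 0 < v1 x.
Proof.
intros [hu hv e0 e1 f0 f1] hx.
destruct (airy_growth u u1 0 x hu); try lra.
destruct (airy_growth v v1 0 x hv); lra.
Qed.

(** [xi = - a] corresponds to the midpoint [x = 0] of the cell.  For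
    [odd = false] the combination [left_sol] of [u] and [v] has slope zero
    there, for [odd = true] it vanishes there; its
    coefficients are the [left_data] of [v] and of [u]. *)
Definition left_data (v v1 : R -> R) (odd : bool) (a : R) :=
  if odd then v (- a) else v1 (- a).

Definition left_sol (u u1 v v1 : R -> R) (odd : bool) (a x : R) : R :=
  left_data v v1 odd a * u x - left_data u u1 odd a * v x.

Definition left_sol1 (u u1 v v1 : R -> R) (odd : bool) (a x : R) : R :=
  left_data v v1 odd a * u1 x - left_data u u1 odd a * v1 x.

(** The condition at [xi = cc - a], which corresponds to [x = L0]: slope zero
    if [neumann], value zero otherwise. *)
Definition right_cond (u u1 v v1 : R -> R) (odd neumann : bool) (cc a : R) : Prop :=
  (if neumann then left_sol1 u u1 v v1 odd a (cc - a)
   else left_sol u u1 v v1 odd a (cc - a)) = 0.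

Definition left_data' (v v1 : R -> R) (odd : bool) (a : R) :=
  if odd then - v1 (- a) else a * v (- a).

Lemma left_data_derive v v1 o a : airy v v1 ->
  is_derive (left_data v v1 o) a (left_data' v v1 o a).
Proof.
intros hv; pose proof (airy_derive _ _ hv) as b0; pose proof (airy_derive_slope _ _ hv) as b1.
destruct o; unfold left_data, left_data'; auto_derive.
- repeat split; eexists; eauto.
- use_derive b0; ring.
- repeat split; eexists; eauto.
- use_derive b1; ring.
Qed.

Lemma left_sol_airy u u1 v v1 o a : fundamental u u1 v v1 ->
  airy (left_sol u u1 v v1 o a) (left_sol1 u u1 v v1 o a).
Proof.
intros [hu hv _ _ _ _]; exact (airy_combination u u1 v v1 _ _ hu hv).
Qed.

(** The value at [- a] of the decreasing quantity [y1 ^ 2 - x y ^ 2] of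
    [left_sol].  It is at the same time the Wronskian in [a] of the two
    coefficients; this coincidence makes the derivative in
    [dirichlet_unique] positive. *)
Definition left_energy (o : bool) (a : R) : R := if o then 1 else a.

Lemma left_sol_energy u u1 v v1 o a : fundamental u u1 v v1 ->
  left_sol1 u u1 v v1 o a (- a) ^ 2 - (- a) * left_sol u u1 v v1 o a (- a) ^ 2
  = left_energy o a.
Proof.
intros hf; pose proof (fund_wronskian _ _ _ _ (- a) hf) as w.
unfold left_sol, left_sol1, left_data, left_energy; destruct o.
- replace (v (-a) * u1 (-a) - u (-a) * v1 (-a)) with (-1) by lra; ring.
- replace (v1 (-a) * u (-a) - u1 (-a) * v (-a)) with 1 by lra; ring.
Qed.

Lemma left_data_wronskian u u1 v v1 o a : fundamental u u1 v v1 ->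
  left_data v v1 o a * left_data' u u1 o a - left_data' v v1 o a * left_data u u1 o a
  = left_energy o a.
Proof.
intros hf; pose proof (fund_wronskian _ _ _ _ (- a) hf) as w.
unfold left_data, left_data', left_energy; destruct o.
- lra.
- replace a with (a * 1) at 7 by ring; rewrite <- w; ring.
Qed.

Lemma left_data_not_both u u1 v v1 o a : fundamental u u1 v v1 ->
  left_data v v1 o a = 0 -> left_data u u1 o a = 0 -> False.
Proof.
intros hf e1 e2; pose proof (fund_wronskian _ _ _ _ (- a) hf) as w.
unfold left_data in *; destruct o; rewrite e1, e2 in w; lra.
Qed.

(** * The two band edges in one interval *)
Section OneBand.
Variables (u u1 v v1 : R -> R).
Hypothesis hf : fundamental u u1 v v1.
Variables (o : bool) (cc l r : R).
Hypothesis (hl : 0 <= l) (hlr : l < r) (hr : r < cc).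
Let p := left_data v v1 o.
Let q := left_data u u1 o.
Hypothesis hpq : forall a, l < a < r -> 0 < p a * q a.
Hypothesis hql : q l = 0.
Hypothesis hpr : p r = 0.

Let dp a : is_derive p a (left_data' v v1 o a) := left_data_derive v v1 o a (fund_v _ _ _ _ hf).
Let dq a : is_derive q a (left_data' u u1 o a) := left_data_derive u u1 o a (fund_u _ _ _ _ hf).
Let end_value a := left_sol u u1 v v1 o a (cc - a).
Let end_slope a := left_sol1 u u1 v v1 o a (cc - a).

Lemma end_value_derive a : is_derive end_value a
  (- end_slope a + (left_data' v v1 o a * u (cc - a) - left_data' u u1 o a * v (cc - a))).
Proof.
pose proof (airy_derive _ _ (fund_u _ _ _ _ hf)) as a0.
pose proof (airy_derive _ _ (fund_v _ _ _ _ hf)) as b0.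
unfold end_value, end_slope, left_sol, left_sol1; fold p q; auto_derive.
- repeat split; eexists; eauto.
- use_derive a0; use_derive b0; use_derive dp; use_derive dq; unfold Rminus; ring.
Qed.

Lemma end_slope_derive a : is_derive end_slope a
  (- (cc - a) * end_value a +
   (left_data' v v1 o a * u1 (cc - a) - left_data' u u1 o a * v1 (cc - a))).
Proof.
pose proof (airy_derive_slope _ _ (fund_u _ _ _ _ hf)) as a0.
pose proof (airy_derive_slope _ _ (fund_v _ _ _ _ hf)) as b0.
unfold end_value, end_slope, left_sol, left_sol1; fold p q; auto_derive.
- repeat split; eexists; eauto.
- use_derive a0; use_derive b0; use_derive dp; use_derive dq; unfold Rminus; ring.
Qed.

Lemma q_ne a : l < a < r -> q a <> 0.
Proof. intros h e; specialize (hpq a h); rewrite e in hpq; lra. Qed.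

Lemma p_ne a : l < a < r -> p a <> 0.
Proof. intros h e; specialize (hpq a h); rewrite e in hpq; lra. Qed.

(** The derivative of [p / q] is minus the Wronskian of [p] and [q] in [a],
    which is [left_energy], over [q ^ 2]. *)
Lemma ratio_decr a a' : l < a -> a < a' -> a' < r -> p a' / q a' < p a / q a.
Proof.
intros h1 h2 h3.
cut (- (p a / q a) < - (p a' / q a')); [lra |].
apply (derive_pos_lt (fun a => - (p a / q a)) (fun a => left_energy o a / q a ^ 2)); auto.
- intros t ht; assert (qn : q t <> 0) by (apply q_ne; lra).
  rewrite <- (left_data_wronskian u u1 v v1 o t hf); fold p q.
  auto_derive; [repeat split; try (eexists; eauto); auto | use_derive dp; use_derive dq; field; auto].
- intros t ht; assert (qn : q t <> 0) by (apply q_ne; lra).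
  assert (0 < q t ^ 2) by nra.
  apply Rdiv_lt_0_compat; auto; unfold left_energy; destruct o; lra.
Qed.

(** The derivative of [v1 / u1] is [- x / u1 ^ 2], by the Wronskian. *)
Lemma neumann_ratio_decr b b' : 0 < b -> b < b' -> v1 b' / u1 b' < v1 b / u1 b.
Proof.
intros hb hb'.
pose proof (airy_derive_slope _ _ (fund_u _ _ _ _ hf)) as a1.
pose proof (airy_derive_slope _ _ (fund_v _ _ _ _ hf)) as b1.
cut (- (v1 b / u1 b) < - (v1 b' / u1 b')); [lra |].
apply (derive_pos_lt (fun a => - (v1 a / u1 a)) (fun a => a / u1 a ^ 2)); auto.
- intros t ht; destruct (fund_pos _ _ _ _ t hf) as (?&?&?&?); [lra |].
  auto_derive; [repeat split; try (eexists; eauto); lra | use_derive a1; use_derive b1].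
  replace (t / u1 t ^ 2) with (t * (u t * v1 t - u1 t * v t) / u1 t ^ 2)
    by (rewrite (fund_wronskian _ _ _ _ t hf); field; lra).
  field; lra.
- intros t ht; destruct (fund_pos _ _ _ _ t hf) as (?&?&?&?); [lra |].
  apply Rdiv_lt_0_compat; nra.
Qed.

Lemma dirichlet_zero_ratio a : l < a < r -> end_value a = 0 -> p a / q a = v (cc - a) / u (cc - a).
Proof.
intros h e; pose proof (q_ne a h).
destruct (fund_pos _ _ _ _ (cc - a) hf) as (?&?&?&?); [lra |].
unfold end_value, left_sol in e; fold p q in e.
apply (Rmult_eq_reg_r (q a * u (cc - a))); [ | nra].
field_simplify; lra.
Qed.

Lemma neumann_zero_ratio a : l < a < r -> end_slope a = 0 -> p a / q a = v1 (cc - a) / u1 (cc - a).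
Proof.
intros h e; pose proof (q_ne a h).
destruct (fund_pos _ _ _ _ (cc - a) hf) as (?&?&?&?); [lra |].
unfold end_slope, left_sol1 in e; fold p q in e.
apply (Rmult_eq_reg_r (q a * u1 (cc - a))); [ | nra].
field_simplify; lra.
Qed.

Lemma dirichlet_lt_neumann_ratio b : 0 < b -> v b / u b < v1 b / u1 b.
Proof.
intros hb; destruct (fund_pos _ _ _ _ b hf) as (?&?&?&?); [lra |].
pose proof (fund_wronskian _ _ _ _ b hf).
assert (v1 b / u1 b - v b / u b = 1 / (u b * u1 b)).
{ replace (1 / (u b * u1 b)) with ((u b * v1 b - u1 b * v b) / (u b * u1 b))
    by (rewrite (fund_wronskian _ _ _ _ b hf); field; lra).
  field; lra. }
assert (0 < 1 / (u b * u1 b)) by (apply Rdiv_lt_0_compat; nra).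
lra.
Qed.

(** A zero of [end_slope] says [p / q = v1 / u1] at [cc - a], a zero of
    [end_value] says [p / q = v / u] there.  As [a] grows, [p / q] falls and
    [v1 / u1] rises, so [p / q] comes down to the smaller ratio [v / u] only after the
    zero of [end_slope]. *)
Lemma neumann_before_dirichlet a b : l < a < r -> l < b < r -> end_slope a = 0 -> end_value b = 0 -> a < b.
Proof.
intros ha hb ea eb.
destruct (Rlt_le_dec a b) as [h | h]; auto; exfalso.
assert (p a / q a <= p b / q b).
{ destruct h as [h | ->]; [left; apply ratio_decr; lra | lra]. }
assert (v1 (cc - b) / u1 (cc - b) <= v1 (cc - a) / u1 (cc - a)).
{ destruct h as [h | ->]; [left; apply neumann_ratio_decr; lra | lra]. }
pose proof (dirichlet_lt_neumann_ratio (cc - b)).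
rewrite (neumann_zero_ratio a), (dirichlet_zero_ratio b) in * by auto.
lra.
Qed.

Lemma neumann_unique a b : l < a < r -> l < b < r -> end_slope a = 0 -> end_slope b = 0 -> a < b -> False.
Proof.
intros ha hb ea eb h.
pose proof (ratio_decr a b).
pose proof (neumann_ratio_decr (cc - b) (cc - a)).
rewrite (neumann_zero_ratio a), (neumann_zero_ratio b) in * by auto.
lra.
Qed.

(** Both [p / q] and [v / u] fall as [a] grows, so comparing them is not
    enough.  But beyond the zero of [end_slope] the quotient
    [end_value / end_slope] is defined, and its derivative is the loss of
    [y1 ^ 2 - x y ^ 2] between [- a] and [cc - a] over [end_slope ^ 2]. *)
Lemma dirichlet_unique k a b : l < k < r -> end_slope k = 0 ->
  l < a < r -> l < b < r -> end_value a = 0 -> end_value b = 0 -> a < b -> False.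
Proof.
intros hk ek ha hb ea eb h.
assert (kn : forall t, a <= t <= b -> end_slope t <> 0).
{ intros t ht e; assert (k < a) by (apply neumann_before_dirichlet; auto).
  apply (neumann_unique k t); auto; lra. }
assert (hlt : end_value a / end_slope a < end_value b / end_slope b).
{ apply (derive_pos_lt (fun t => end_value t / end_slope t) (fun t =>
     (left_energy o t - (end_slope t ^ 2 - (cc - t) * end_value t ^ 2)) / end_slope t ^ 2)); auto.
  - intros t ht; specialize (kn t ht).
    pose proof end_value_derive as d1; pose proof end_slope_derive as d2.
    auto_derive; [repeat split; try (eexists; eauto); lra | use_derive d1; use_derive d2].
    rewrite <- (left_data_wronskian u u1 v v1 o t hf).
    pose proof (fund_wronskian _ _ _ _ (cc - t) hf) as w.
    fold p q.
    replace (p t * left_data' u u1 o t - left_data' v v1 o t * q t) with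
      ((p t * left_data' u u1 o t - left_data' v v1 o t * q t) *
       (u (cc - t) * v1 (cc - t) - u1 (cc - t) * v (cc - t))) by (rewrite w; ring).
    field_simplify_eq; auto.
    unfold end_slope, end_value, left_sol, left_sol1; fold p q; ring.
  - intros t ht; specialize (kn t); assert (end_slope t <> 0) by (apply kn; lra).
    apply Rdiv_lt_0_compat; [ | nra].
    assert (hE : 0 < left_energy o t) by (unfold left_energy; destruct o; lra).
    pose proof (airy_energy_lt _ _ (- t) (cc - t) (left_sol_airy u u1 v v1 o t hf)) as en.
    rewrite left_sol_energy in en by auto.
    fold (end_value t) (end_slope t) in en.
    assert (- t < cc - t) by lra; specialize (en H0 hE); lra. }
rewrite ea, eb in hlt; unfold Rdiv in hlt; lra.
Qed.

(** At [l] the end value and slope have the sign of [p l], at [r] the sign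
    of [- q r]; since [p] and [q] have equal signs in between, both quantities
    change sign. *)
Lemma band_points : exists alpha beta, l < alpha /\ alpha < beta /\ beta < r /\
  (forall a, l < a < r -> (right_cond u u1 v v1 o true cc a <-> a = alpha)) /\
  (forall a, l < a < r -> (right_cond u u1 v v1 o false cc a <-> a = beta)).
Proof.
assert (cp : forall t, continuity_pt p t) by (intros; eapply is_derive_continuity_pt; apply dp).
assert (cq : forall t, continuity_pt q t) by (intros; eapply is_derive_continuity_pt; apply dq).
assert (cG : forall t, continuity_pt end_value t) by (intros; eapply is_derive_continuity_pt; apply end_value_derive).
assert (cK : forall t, continuity_pt end_slope t) by (intros; eapply is_derive_continuity_pt; apply end_slope_derive).
assert (pl : p l <> 0) by (intros e; eapply left_data_not_both; eauto).
assert (qr : q r <> 0) by (intros e; eapply left_data_not_both; eauto).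
set (m := (l + r) / 2).
assert (h1 : 0 < p l * p m).
{ apply nonzero_same_sign; auto; [unfold m; lra |].
  intros t ht; destruct (Req_dec t l) as [-> | hn]; auto; apply p_ne; unfold m in *; lra. }
assert (h2 : 0 < q m * q r).
{ apply nonzero_same_sign; auto; [unfold m; lra |].
  intros t ht; destruct (Req_dec t r) as [-> | hn]; auto; apply q_ne; unfold m in *; lra. }
assert (h3 : 0 < p m * q m) by (apply hpq; unfold m; lra).
assert (h4 : 0 < p l * q r).
{ assert (p m <> 0) by nra. assert (q m <> 0) by nra.
  assert (0 < (p l * p m) * (q m * q r)) by nra.
  assert (0 < (p l * q r) * (p m * q m)) by nra. nra. }
destruct (fund_pos _ _ _ _ (cc - l) hf) as (?&?&?&?); [lra |].
destruct (fund_pos _ _ _ _ (cc - r) hf) as (?&?&?&?); [lra |].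
assert (Gl : end_value l = p l * u (cc - l)) by (unfold end_value, left_sol; fold p q; rewrite hql; ring).
assert (Gr : end_value r = - q r * v (cc - r)) by (unfold end_value, left_sol; fold p q; rewrite hpr; ring).
assert (Kl : end_slope l = p l * u1 (cc - l)) by (unfold end_slope, left_sol1; fold p q; rewrite hql; ring).
assert (Kr : end_slope r = - q r * v1 (cc - r)) by (unfold end_slope, left_sol1; fold p q; rewrite hpr; ring).
assert (ex : forall f, (forall t, continuity_pt f t) -> f l * f r < 0 -> exists t, l < t < r /\ f t = 0).
{ intros f hc hs; destruct (intermediate_zero f l r) as [t [ht e]]; auto; try lra.
  exists t; split; auto.
  destruct (Req_dec t l) as [-> | ]; [nra |].
  destruct (Req_dec t r) as [-> | ]; [nra |]. lra. }
destruct (ex end_slope) as [al [ha ea]]; auto.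
{ rewrite Kl, Kr. assert (0 < u1 (cc - l) * v1 (cc - r)) by nra. nra. }
destruct (ex end_value) as [be [hb eb]]; auto.
{ rewrite Gl, Gr. assert (0 < u (cc - l) * v (cc - r)) by nra. nra. }
exists al, be; repeat split; try lra.
- now apply neumann_before_dirichlet.
- intros e; destruct (Rtotal_order a al) as [h | [h | h]]; auto; exfalso.
  + apply (neumann_unique a al); auto.
  + apply (neumann_unique al a); auto.
- intros ->; exact ea.
- intros e; destruct (Rtotal_order a be) as [h | [h | h]]; auto; exfalso.
  + apply (dirichlet_unique al a be); auto.
  + apply (dirichlet_unique al be a); auto.
- intros ->; exact eb.
Qed.
End OneBand.

(** * The Pruefer angle *)
Lemma primitive_pos (h : R -> R) w0 : 0 < w0 -> (forall w, 0 < w -> continuous h w) ->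
  forall w, 0 < w -> is_derive (RInt h w0) w (h w).
Proof.
intros h0 hc w hw.
apply (is_derive_RInt h (RInt h w0) w0 w); auto.
exists (mkposreal w hw); intros s hs.
unfold ball in hs; simpl in hs; unfold AbsRing_ball, abs, minus, plus, opp in hs; simpl in hs.
apply Rabs_def2 in hs.
apply (RInt_correct (V := R_CompleteNormedModule)), ex_RInt_continuous; intros t ht; apply hc.
apply Rlt_le_trans with (Rmin w0 s); [ apply Rmin_glb_lt; lra | apply ht].
Qed.

(** The angle is the integral of its known derivative.  In the frame turned
    by that angle, the tangential component [T] satisfies
    [T' = T N' / (2 N)] with [N = A ^ 2 + B ^ 2], so [T ^ 2 / N] is constant,
    hence zero; the radial component then is [rho]. *)
Lemma angle_lift (A B A' B' : R -> R) w0 phi0 rho0 :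
  0 < w0 ->
  (forall w, 0 < w -> is_derive A w (A' w) /\ is_derive B w (B' w)) ->
  (forall w, 0 < w -> ex_derive A' w /\ ex_derive B' w) ->
  (forall w, 0 < w -> 0 < A w ^ 2 + B w ^ 2) ->
  0 < rho0 -> A w0 = rho0 * sin phi0 -> B w0 = rho0 * cos phi0 ->
  exists phi rho : R -> R, phi w0 = phi0 /\
  forall w, 0 < w -> 0 < rho w /\ A w = rho w * sin (phi w) /\ B w = rho w * cos (phi w) /\
     is_derive phi w ((A' w * B w - A w * B' w) / (A w ^ 2 + B w ^ 2)).
Proof.
intros h0 hd hc hN hr eA eB.
set (h := fun w => (A' w * B w - A w * B' w) / (A w ^ 2 + B w ^ 2)).
assert (hcont : forall w, 0 < w -> continuous h w).
{ intros w hw; destruct (hd w hw) as [dA dB]; destruct (hc w hw) as [cA cB].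
  specialize (hN w hw).
  apply (ex_derive_continuous h); unfold h; auto_derive.
  repeat split; try assumption; try (eexists; eassumption); lra. }
set (phi := fun w => phi0 + RInt h w0 w).
assert (dphi : forall w, 0 < w -> is_derive phi w (h w)).
{ intros w hw; unfold phi.
  replace (h w) with (plus 0 (h w)) by (unfold plus; simpl; ring).
  apply (is_derive_plus (fun _ => phi0)); [apply (is_derive_const (V := R_NormedModule)) | now apply primitive_pos]. }
set (S := fun w => A w * sin (phi w) + B w * cos (phi w)).
set (T := fun w => A w * cos (phi w) - B w * sin (phi w)).
assert (e0 : phi w0 = phi0) by (unfold phi; rewrite RInt_point; unfold zero; simpl; ring).
assert (hST : forall w, S w ^ 2 + T w ^ 2 = A w ^ 2 + B w ^ 2).
{ intros w; unfold S, T; pose proof (sin2_cos2 (phi w)) as sc; unfold Rsqr in sc.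
  replace (A w ^ 2 + B w ^ 2) with ((A w ^ 2 + B w ^ 2) * (sin (phi w) * sin (phi w) + cos (phi w) * cos (phi w))) by (rewrite sc; ring).
  ring. }
assert (hA : forall w, A w = S w * sin (phi w) + T w * cos (phi w)).
{ intros w; unfold S, T; pose proof (sin2_cos2 (phi w)) as sc; unfold Rsqr in sc.
  rewrite <- (Rmult_1_r (A w)) at 1; rewrite <- sc; ring. }
assert (hB : forall w, B w = S w * cos (phi w) - T w * sin (phi w)).
{ intros w; unfold S, T; pose proof (sin2_cos2 (phi w)) as sc; unfold Rsqr in sc.
  rewrite <- (Rmult_1_r (B w)) at 1; rewrite <- sc; ring. }
assert (dS : forall w, 0 < w -> is_derive S w (A' w * sin (phi w) + B' w * cos (phi w) + h w * T w)).
{ intros w hw; destruct (hd w hw) as [dA dB]; specialize (dphi w hw); unfold S, T.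
  auto_derive; [repeat split; eexists; eauto |].
  rewrite (is_derive_unique (fun x : R => A x) _ _ dA), (is_derive_unique (fun x : R => B x) _ _ dB),
    (is_derive_unique (fun x : R => phi x) _ _ dphi); ring. }
assert (dT : forall w, 0 < w -> is_derive T w (A' w * cos (phi w) - B' w * sin (phi w) - h w * S w)).
{ intros w hw; destruct (hd w hw) as [dA dB]; specialize (dphi w hw); unfold S, T.
  auto_derive; [repeat split; eexists; eauto |].
  rewrite (is_derive_unique (fun x : R => A x) _ _ dA), (is_derive_unique (fun x : R => B x) _ _ dB),
    (is_derive_unique (fun x : R => phi x) _ _ dphi); ring. }
set (Q := fun w => T w ^ 2 / (A w ^ 2 + B w ^ 2)).
assert (dQ : forall w, 0 < w -> is_derive Q w 0).
{ intros w hw; destruct (hd w hw) as [dA dB]; specialize (dT w hw); specialize (hN w hw).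
  unfold Q; auto_derive; [repeat split; try (eexists; eauto); nra |].
  rewrite (is_derive_unique (fun x : R => A x) _ _ dA), (is_derive_unique (fun x : R => B x) _ _ dB),
    (is_derive_unique (fun x : R => T x) _ _ dT).
  set (X := A' w * cos (phi w) - B' w * sin (phi w)).
  set (Z := A' w * sin (phi w) + B' w * cos (phi w)).
  assert (e1 : A' w * B w - A w * B' w = S w * X - T w * Z).
  { rewrite (hA w), (hB w); unfold X, Z; ring. }
  assert (e2 : A w * A' w + B w * B' w = S w * Z + T w * X).
  { rewrite (hA w), (hB w) at 1; unfold X, Z; ring. }
  transitivity (2 * T w * (X * (A w ^ 2 + B w ^ 2) - (A' w * B w - A w * B' w) * S w
     - T w * (A w * A' w + B w * B' w)) / (A w ^ 2 + B w ^ 2) ^ 2).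
  { unfold h; field; nra. }
  rewrite e1, e2.
  replace (X * (A w ^ 2 + B w ^ 2)) with (X * (S w ^ 2 + T w ^ 2)) by (rewrite hST; ring).
  replace (_ - T w * (S w * Z + T w * X)) with 0 by ring.
  unfold Rdiv; ring. }
assert (scr := sin2_cos2 phi0); unfold Rsqr in scr.
assert (T0 : T w0 = 0) by (unfold T; rewrite e0, eA, eB; ring).
assert (S0 : S w0 = rho0).
{ unfold S; rewrite e0, eA, eB; rewrite <- (Rmult_1_r rho0) at 3; rewrite <- scr; ring. }
assert (hT : forall w, 0 < w -> T w = 0).
{ intros w hw; specialize (hN w hw).
  assert (eQ : Q w = Q w0).
  { destruct (Rtotal_order w w0) as [hlt | [-> | hlt]]; auto.
    - destruct (mean_value Q (fun _ => 0) w w0 hlt) as [t [_ e]]; [intros; apply dQ; lra | lra].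
    - destruct (mean_value Q (fun _ => 0) w0 w hlt) as [t [_ e]]; [intros; apply dQ; lra | lra]. }
  unfold Q in eQ; rewrite T0 in eQ.
  assert (e : T w ^ 2 = 0).
  { replace (T w ^ 2) with (T w ^ 2 / (A w ^ 2 + B w ^ 2) * (A w ^ 2 + B w ^ 2)) by (field; lra).
    rewrite eQ; unfold Rdiv; ring. }
  nra. }
assert (hS : forall w, 0 < w -> S w <> 0).
{ intros w hw e; specialize (hST w); specialize (hN w hw); rewrite e, hT in hST by auto; lra. }
exists phi, S; split; auto; intros w hw; split; [ | split; [ | split]].
- assert (cS : forall t, 0 < t -> continuity_pt S t) by (intros; eapply is_derive_continuity_pt; apply dS; auto).
  assert (0 < S w * S w0); [ | rewrite S0 in *; nra].
  destruct (Rle_lt_dec w w0).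
  + apply nonzero_same_sign; auto; intros; [apply cS | apply hS]; lra.
  + rewrite Rmult_comm; apply nonzero_same_sign; [lra | |]; intros; [apply cS | apply hS]; lra.
- rewrite (hA w), hT by auto; ring.
- rewrite (hB w), hT by auto; ring.
- now apply dphi.
Qed.

(** The Airy equation in [z = - x]. *)
Definition oscillator (Y Y1 : R -> R) : Prop :=
  forall z, is_derive Y z (Y1 z) /\ is_derive Y1 z (- z * Y z).

(** Polar coordinates in the variable [w = sqrt z], with [Y] weighted by the
    local frequency [w]: this removes the leading oscillation and leaves an
    angle that follows [2 / 3 * w ^ 3] closely. *)
Definition phase_of (Y Y1 phi rho : R -> R) : Prop :=
  forall w, 0 < w -> 0 < rho w /\ w * Y (w ^ 2) = rho w * sin (phi w) /\
    Y1 (w ^ 2) = rho w * cos (phi w) /\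
    is_derive phi w (2 * w ^ 2 + sin (phi w) * cos (phi w) / w).

Lemma phase_exists Y Y1 w0 phi0 rho0 :
  oscillator Y Y1 -> (forall z, Y z = 0 -> Y1 z = 0 -> False) ->
  0 < w0 -> 0 < rho0 ->
  w0 * Y (w0 ^ 2) = rho0 * sin phi0 -> Y1 (w0 ^ 2) = rho0 * cos phi0 ->
  exists phi rho, phi w0 = phi0 /\ phase_of Y Y1 phi rho.
Proof.
intros hY hn h0 hr es ec.
assert (d0 : forall z, is_derive Y z (Y1 z)) by apply hY.
assert (d1 : forall z, is_derive Y1 z (- z * Y z)) by apply hY.
destruct (angle_lift (fun w => w * Y (w ^ 2)) (fun w => Y1 (w ^ 2))
  (fun w => Y (w ^ 2) + 2 * w ^ 2 * Y1 (w ^ 2)) (fun w => - 2 * w ^ 3 * Y (w ^ 2)) w0 phi0 rho0)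
  as [phi [rho [e h]]]; auto.
- intros w hw; split; auto_derive.
  + repeat split; eexists; eauto.
  + use_derive d0; ring_simplify; simpl; ring.
  + repeat split; eexists; eauto.
  + use_derive d1; simpl; ring.
- intros w hw; split; auto_derive; repeat split; eexists; eauto.
- intros w hw.
  destruct (Req_dec (Y (w ^ 2)) 0) as [e | n].
  + assert (Y1 (w ^ 2) <> 0) by (intros e1; apply (hn _ e e1)). nra.
  + assert (w * Y (w ^ 2) <> 0) by (apply Rmult_integral_contrapositive; split; lra). nra.
- exists phi, rho; split; auto; intros w hw.
  destruct (h w hw) as (h1 & h2 & h3 & h4); split; [auto | split; [auto | split; [auto |]]].
  replace (2 * w ^ 2 + sin (phi w) * cos (phi w) / w) with
   (((Y (w ^ 2) + 2 * w ^ 2 * Y1 (w ^ 2)) * Y1 (w ^ 2) - w * Y (w ^ 2) * (-2 * w ^ 3 * Y (w ^ 2))) / ((w * Y (w ^ 2)) ^ 2 + Y1 (w ^ 2) ^ 2)); auto.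
  assert (hy : Y (w ^ 2) = rho w * sin (phi w) / w) by (rewrite <- h2; field; lra).
  rewrite h3, hy.
  assert (sc := sin2_cos2 (phi w)); unfold Rsqr in sc.
  assert (e1 : (w * (rho w * sin (phi w) / w)) ^ 2 + (rho w * cos (phi w)) ^ 2 = rho w ^ 2).
  { rewrite <- (Rmult_1_r (rho w ^ 2)), <- sc; field; lra. }
  rewrite e1.
  transitivity (2 * w ^ 2 * (sin (phi w) * sin (phi w) + cos (phi w) * cos (phi w)) + sin (phi w) * cos (phi w) / w).
  + field; lra.
  + rewrite sc; ring.
Qed.

Lemma phase_increasing Y Y1 phi rho w w' : phase_of Y Y1 phi rho ->
  1 <= w -> w < w' -> phi w < phi w'.
Proof.
intros h hw hlt.
apply (derive_pos_lt phi (fun w => 2 * w ^ 2 + sin (phi w) * cos (phi w) / w)); auto.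
- intros t ht; apply h; lra.
- intros t ht.
  assert (sc := sin2_cos2 (phi t)); unfold Rsqr in sc.
  assert (-1 <= sin (phi t) * cos (phi t)) by nra.
  assert (-1 <= sin (phi t) * cos (phi t) / t).
  { apply Rmult_le_reg_r with t; [lra |].
    replace (sin (phi t) * cos (phi t) / t * t) with (sin (phi t) * cos (phi t)) by (field; lra). lra. }
  nra.
Qed.

(** Adding [cos ^ 2 / (4 w ^ 3)] to [phi - 2 / 3 w ^ 3], or subtracting
    [sin ^ 2 / (4 w ^ 3)] from it, cancels the term [sin cos / w] of the
    derivative, which is not absolutely integrable at infinity.  What is left
    has a sign: the first quantity decreases and the second one increases.
    Thus the deviation at one point bounds it for all larger [w]. *)
Lemma phase_bounds Y Y1 phi rho w w' : phase_of Y Y1 phi rho ->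
  0 < w -> w <= w' ->
  phi w - 2 / 3 * w ^ 3 - sin (phi w) ^ 2 / (4 * w ^ 3) <= phi w' - 2 / 3 * w' ^ 3
  <= phi w - 2 / 3 * w ^ 3 + cos (phi w) ^ 2 / (4 * w ^ 3).
Proof.
intros h hw hlt.
assert (pw : forall t, 0 < t -> 0 < 4 * t ^ 3) by (intros t ht; assert (0 < t ^ 3) by (apply pow_lt; auto); lra).
assert (dp : forall t, w <= t -> is_derive phi t (2 * t ^ 2 + sin (phi t) * cos (phi t) / t)).
{ intros t ht; apply h; lra. }
split.
- apply Rle_trans with (phi w' - 2 / 3 * w' ^ 3 - sin (phi w') ^ 2 / (4 * w' ^ 3)).
  + apply (derive_nonneg_le (fun t => phi t - 2 / 3 * t ^ 3 - sin (phi t) ^ 2 / (4 * t ^ 3))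
      (fun t => sin (phi t) ^ 2 / t ^ 4 * (3 / 4 - cos (phi t) ^ 2 / 2))); auto.
    * intros t [ht _]; specialize (dp t ht); specialize (pw t).
      auto_derive; [repeat split; try (eexists; eauto); lra |].
      rewrite (is_derive_unique (fun x : R => phi x) _ _ dp); field; lra.
    * intros t ht; assert (sc := sin2_cos2 (phi t)); unfold Rsqr in sc.
      apply Rmult_le_pos; [ | nra].
      apply Rmult_le_pos; [nra | left; apply Rinv_0_lt_compat, pow_lt; lra].
  + assert (0 <= sin (phi w') ^ 2 / (4 * w' ^ 3)); [ | lra].
    apply Rmult_le_pos; [nra | left; apply Rinv_0_lt_compat, pw; lra].
- apply Rle_trans with (phi w' - 2 / 3 * w' ^ 3 + cos (phi w') ^ 2 / (4 * w' ^ 3)).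
  + assert (0 <= cos (phi w') ^ 2 / (4 * w' ^ 3)); [ | lra].
    apply Rmult_le_pos; [nra | left; apply Rinv_0_lt_compat, pw; lra].
  + cut (- (phi w - 2 / 3 * w ^ 3 + cos (phi w) ^ 2 / (4 * w ^ 3)) <=
      - (phi w' - 2 / 3 * w' ^ 3 + cos (phi w') ^ 2 / (4 * w' ^ 3))); [lra |].
    apply (derive_nonneg_le (fun t => - (phi t - 2 / 3 * t ^ 3 + cos (phi t) ^ 2 / (4 * t ^ 3)))
      (fun t => cos (phi t) ^ 2 / t ^ 4 * (3 / 4 + sin (phi t) ^ 2 / 2))); auto.
    * intros t [ht _]; specialize (dp t ht); specialize (pw t).
      auto_derive; [repeat split; try (eexists; eauto); lra |].
      rewrite (is_derive_unique (fun x : R => phi x) _ _ dp); field; lra.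
    * intros t ht; assert (sc := sin2_cos2 (phi t)); unfold Rsqr in sc.
      apply Rmult_le_pos; [ | nra].
      apply Rmult_le_pos; [nra | left; apply Rinv_0_lt_compat, pow_lt; lra].
Qed.

Lemma phase_surjective Y Y1 phi rho w0 y : phase_of Y Y1 phi rho ->
  1 <= w0 -> phi w0 < y -> exists w, w0 < w /\ phi w = y.
Proof.
intros h hw hy.
(* [2 / 3 * w ^ 3] grows at least at rate [2], which outweighs the bounded
   deviation. *)
set (w1 := w0 + (y - phi w0 + 1)).
assert (hb := phase_bounds Y Y1 phi rho w0 w1 h).
assert (hs : sin (phi w0) ^ 2 / (4 * w0 ^ 3) <= 1).
{ assert (sc := sin2_cos2 (phi w0)); unfold Rsqr in sc.
  assert (1 <= w0 ^ 3) by (apply pow_R1_Rle; auto).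
  apply Rmult_le_reg_r with (4 * w0 ^ 3); [lra |].
  unfold Rdiv; rewrite Rmult_assoc, Rinv_l by lra. nra. }
assert (h1 : y < phi w1).
{ destruct hb as [hb _]; [lra | unfold w1; lra |].
  assert (w1 ^ 3 - w0 ^ 3 >= 3 * (w1 - w0)).
  { assert (1 <= w1) by (unfold w1; lra).
    replace (w1 ^ 3 - w0 ^ 3) with ((w1 - w0) * (w1 ^ 2 + w1 * w0 + w0 ^ 2)) by ring.
    assert (0 <= w1 - w0) by (unfold w1; lra).
    assert (3 <= w1 ^ 2 + w1 * w0 + w0 ^ 2) by nra. nra. }
  assert (w1 - w0 = y - phi w0 + 1) by (unfold w1; ring).
  lra. }
destruct (intermediate_zero (fun w => phi w - y) w0 w1) as [w [hw1 e]].
- unfold w1; lra.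
- intros t ht; eapply is_derive_continuity_pt.
  assert (dp : is_derive phi t (2 * t ^ 2 + sin (phi t) * cos (phi t) / t)) by (apply h; lra).
  apply (is_derive_minus (V := R_NormedModule) phi (fun _ => y)); [apply dp | apply (is_derive_const (V := R_NormedModule))].
- assert (0 < phi w1 - y) by lra; nra.
- exists w; split; [ | lra].
  destruct (Req_dec w w0) as [-> | ]; lra.
Qed.

(** * Values of the Airy functions at -36/25 *)
Lemma abs_le_of_derive (f f' : R -> R) K n z : f 0 = 0 ->
  (forall t, 0 <= t <= z -> is_derive f t (f' t)) ->
  (forall t, 0 <= t <= z -> Rabs (f' t) <= K * t ^ n) ->
  forall t, 0 <= t <= z -> Rabs (f t) <= K * t ^ (S n) / INR (S n).
Proof.
intros f0 hd hb t ht.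
assert (hn : 0 < INR (S n)) by (apply lt_0_INR; lia).
set (g := fun s => K * s ^ (S n) / INR (S n)).
assert (g0 : g 0 = 0) by (unfold g; simpl pow; unfold Rdiv; ring).
assert (dg : forall s, is_derive g s (K * s ^ n)).
{ intros s; unfold g.
  apply (is_derive_ext (fun s => K / INR (S n) * s ^ S n)); [intros s'; change (K / INR (S n) * s' ^ S n = K * s' ^ S n / INR (S n)); unfold Rdiv; ring |].
  assert (E : K * s ^ n = K / INR (S n) * (INR (S n) * 1 * s ^ n)) by (field; lra).
  rewrite E.
  apply is_derive_scal, (is_derive_pow (fun x => x) (S n) s 1), (is_derive_id (K := R_AbsRing)). }
apply Rabs_le; change (- g t <= f t <= g t); split.
- cut (f 0 + g 0 <= f t + g t); [lra |].
  apply (derive_nonneg_le (fun s => f s + g s) (fun s => f' s + K * s ^ n)); try lra.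
  + intros s hs; apply (is_derive_plus (V := R_NormedModule) f g); [apply hd; lra | apply dg].
  + intros s hs; assert (h := hb s ltac:(lra)); apply Rabs_le_between in h; lra.
- cut (g 0 - f 0 <= g t - f t); [lra |].
  apply (derive_nonneg_le (fun s => g s - f s) (fun s => K * s ^ n - f' s)); try lra.
  + intros s hs; apply (is_derive_minus (V := R_NormedModule) g f); [apply dg | apply hd; lra].
  + intros s hs; assert (h := hb s ltac:(lra)); apply Rabs_le_between in h; lra.
Qed.

(** One step of Picard iteration: if [g] is an error of size [t ^ n], then the
    error after integrating [- t g] twice is of size [t ^ (n + 3)]. *)
Lemma oscillator_step (e e1 g : R -> R) K n z : e 0 = 0 -> e1 0 = 0 ->
  (forall t, is_derive e t (e1 t)) -> (forall t, is_derive e1 t (- t * g t)) ->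
  (forall t, 0 <= t <= z -> Rabs (g t) <= K * t ^ n) ->
  (forall t, 0 <= t <= z -> Rabs (e1 t) <= K / INR (S (S n)) * t ^ (S (S n))) /\
  (forall t, 0 <= t <= z -> Rabs (e t) <= K / (INR (S (S n)) * INR (S (S (S n)))) * t ^ (S (S (S n)))).
Proof.
intros e0 e10 d d1 hb.
assert (n2 : 0 < INR (S (S n))) by (apply lt_0_INR; lia).
assert (n3 : 0 < INR (S (S (S n)))) by (apply lt_0_INR; lia).
assert (h1 : forall t, 0 <= t <= z -> Rabs (e1 t) <= K / INR (S (S n)) * t ^ (S (S n))).
{ intros t ht; replace (K / INR (S (S n)) * t ^ S (S n)) with (K * t ^ S (S n) / INR (S (S n))) by (field; lra).
  apply (abs_le_of_derive e1 (fun t => - t * g t) K (S n) z); auto.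
  intros s hs; rewrite Rabs_mult, Rabs_Ropp, (Rabs_pos_eq s) by lra.
  replace (K * s ^ S n) with (s * (K * s ^ n)) by (simpl; ring).
  apply Rmult_le_compat_l; auto; lra. }
split; auto; intros t ht.
replace (K / (INR (S (S n)) * INR (S (S (S n)))) * t ^ (S (S (S n)))) with
  (K / INR (S (S n)) * t ^ (S (S (S n))) / INR (S (S (S n)))) by (field; lra).
apply (abs_le_of_derive e e1 (K / INR (S (S n))) (S (S n)) z); auto.
Qed.

Definition taylor_short (a b t : R) := a * (1 - t ^ 3 / 6) + b * (t - t ^ 4 / 12).
Definition taylor_long (a b t : R) :=
  a * (1 - t ^ 3 / 6 + t ^ 6 / 180 - t ^ 9 / 12960) +
  b * (t - t ^ 4 / 12 + t ^ 7 / 504 - t ^ 10 / 45360).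
Definition taylor_long' (a b t : R) :=
  a * (- t ^ 2 / 2 + t ^ 5 / 30 - t ^ 8 / 1440) +
  b * (1 - t ^ 3 / 3 + t ^ 6 / 72 - t ^ 9 / 4536).

(** The Taylor polynomials are the Picard iterates from zero, so the error of
    each is obtained from that of the preceding one by [oscillator_step].  The
    first error is [Y] itself; [K] bounds it because
    [M <= |a| + 36/25 |b| + M (36/25) ^ 3 / 6] for the maximum [M] of [|Y|] on
    the interval, and [(36/25) ^ 3 / 6 < 1/2]. *)
Lemma oscillator_taylor Y Y1 : oscillator Y Y1 ->
  let K := 2 * Rabs (Y 0) + 3 * Rabs (Y1 0) in
  forall t, 0 <= t <= 36 / 25 ->
  Rabs (Y t - taylor_short (Y 0) (Y1 0) t) <= K / 180 * t ^ 6 /\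
  Rabs (Y t - taylor_long (Y 0) (Y1 0) t) <= K / 1710720 * t ^ 12 /\
  Rabs (Y1 t - taylor_long' (Y 0) (Y1 0) t) <= K / 142560 * t ^ 11.
Proof.
intros hY K.
assert (d0 : forall z, is_derive Y z (Y1 z)) by apply hY.
assert (d1 : forall z, is_derive Y1 z (- z * Y z)) by apply hY.
set (a := Y 0) in *; set (b := Y1 0) in *.
destruct (continuity_ab_maj (fun t => Rabs (Y t)) 0 (36 / 25)) as [s [hs s1]]; [lra | |].
{ intros c hc; apply (continuity_pt_comp Y Rabs); [eapply is_derive_continuity_pt; apply d0 | apply Rcontinuity_abs]. }
set (M := Rabs (Y s)) in *.
assert (step1 := oscillator_step (fun t => Y t - (a + b * t)) (fun t => Y1 t - b) Y M 0 (36 / 25)).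
simpl INR in step1.
destruct step1 as [_ step1].
{ fold a b; ring. }
{ fold b; ring. }
{ intros t; auto_derive; [repeat split; eexists; eauto | use_derive d0; ring]. }
{ intros t; auto_derive; [repeat split; eexists; eauto | use_derive d1; ring]. }
{ intros t ht; simpl; rewrite Rmult_1_r; now apply hs. }
assert (hM : M <= K).
{ specialize (step1 s s1).
  assert (Rabs (a + b * s) <= Rabs a + Rabs b * (36 / 25)).
  { eapply Rle_trans; [apply Rabs_triang |].
    rewrite Rabs_mult, (Rabs_pos_eq s) by lra.
    apply Rplus_le_compat_l, Rmult_le_compat_l; [apply Rabs_pos | lra]. }
  assert (M <= Rabs (Y s - (a + b * s)) + Rabs (a + b * s)).
  { unfold M; replace (Y s) with ((Y s - (a + b * s)) + (a + b * s)) at 1 by ring; apply Rabs_triang. }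
  assert (0 <= M) by apply Rabs_pos.
  assert (s ^ 3 <= (36 / 25) ^ 3) by (apply pow_incr; lra).
  assert (M / ((1 + 1) * (1 + 1 + 1)) * s ^ 3 <= M / 6 * (36 / 25) ^ 3).
  { replace (M / ((1 + 1) * (1 + 1 + 1))) with (M / 6) by (field; lra).
    apply Rmult_le_compat_l; [lra | auto]. }
  pose proof (Rabs_pos a); pose proof (Rabs_pos b).
  unfold K; simpl in *; lra. }
assert (hK : forall t, 0 <= t <= 36 / 25 -> Rabs (Y t) <= K * t ^ 0).
{ intros t ht; simpl; rewrite Rmult_1_r; apply Rle_trans with M; auto. }
clear step1.
assert (step1 := oscillator_step (fun t => Y t - (a + b * t)) (fun t => Y1 t - b) Y K 0 (36 / 25)).
destruct step1 as [_ step1]; auto.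
{ fold a b; ring. }
{ fold b; ring. }
{ intros t; auto_derive; [repeat split; eexists; eauto | use_derive d0; ring]. }
{ intros t; auto_derive; [repeat split; eexists; eauto | use_derive d1; ring]. }
destruct (fun A B C D => oscillator_step
  (fun t => Y t - taylor_short a b t)
   (fun t => Y1 t - (a * (- t ^ 2 / 2) + b * (1 - t ^ 3 / 3)))
  _ _ _ _ A B C D step1) as [_ step2'].
{ unfold taylor_short; fold a b; field. }
{ fold b; field. }
{ intros t; unfold taylor_short; auto_derive; [repeat split; eexists; eauto | use_derive d0; simpl; field]. }
{ intros t; auto_derive; [repeat split; eexists; eauto | use_derive d1; simpl; field]. }
destruct (fun A B C D => oscillator_step
  (fun t => Y t - (a * (1 - t ^ 3 / 6 + t ^ 6 / 180) + b * (t - t ^ 4 / 12 + t ^ 7 / 504)))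
   (fun t => Y1 t - (a * (- t ^ 2 / 2 + t ^ 5 / 30) + b * (1 - t ^ 3 / 3 + t ^ 6 / 72)))
  _ _ _ _ A B C D step2') as [_ step3'].
{ fold a b; field. }
{ fold b; field. }
{ intros t; auto_derive; [repeat split; eexists; eauto | use_derive d0; simpl; field]. }
{ intros t; unfold taylor_short; auto_derive; [repeat split; eexists; eauto | use_derive d1; simpl; field]. }
destruct (fun A B C D => oscillator_step
  (fun t => Y t - taylor_long a b t) (fun t => Y1 t - taylor_long' a b t)
  _ _ _ _ A B C D step3') as [step41 step4'].
{ unfold taylor_long; fold a b; field. }
{ unfold taylor_long'; fold b; field. }
{ intros t; unfold taylor_long, taylor_long'; auto_derive; [repeat split; eexists; eauto | use_derive d0; simpl; field]. }
{ intros t; unfold taylor_long'; auto_derive; [repeat split; eexists; eauto | use_derive d1; simpl; field]. }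
intros t ht.
specialize (step2' t ht); specialize (step41 t ht); specialize (step4' t ht).
clear step1 step3'.
replace (K / 180 * t ^ 6) with (K / (INR 2 * INR 3) / (INR 5 * INR 6) * t ^ 6) by (simpl; field).
replace (K / 1710720 * t ^ 12) with (K / (INR 2 * INR 3) / (INR 5 * INR 6) / (INR 8 * INR 9) / (INR 11 * INR 12) * t ^ 12) by (simpl; field).
replace (K / 142560 * t ^ 11) with (K / (INR 2 * INR 3) / (INR 5 * INR 6) / (INR 8 * INR 9) / INR 11 * t ^ 11) by (simpl; field).
auto.
Qed.

(** * The angles of u and v *)
Lemma PI_bounds : 3.14 < PI < 3.15.
Proof.
pose proof (PI_2_3_7_ineq 3) as h.
unfold tg_alt, PI_2_3_7_tg, Ratan_seq in h; simpl in h.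
lra.
Qed.

Lemma div_le a b k : 0 < b -> a <= k * b -> a / b <= k.
Proof.
intros hb h; apply Rmult_le_reg_r with b; auto.
replace (a / b * b) with a by (field; lra); auto.
Qed.

Lemma le_div a b k : 0 < b -> k * b <= a -> k <= a / b.
Proof.
intros hb h; apply Rmult_le_reg_r with b; auto.
replace (a / b * b) with a by (field; lra); auto.
Qed.

Lemma atan_le_id x : 0 <= x -> atan x <= x.
Proof.
intros hx.
cut (0 - atan 0 <= x - atan x); [rewrite atan_0; lra |].
apply (derive_nonneg_le (fun t => t - atan t) (fun t => t ^ 2 / (1 + t ^ 2))); auto.
- intros t ht; auto_derive; auto; unfold Rsqr; field; nra.
- intros t ht; apply Rmult_le_pos; [nra | left; apply Rinv_0_lt_compat; nra].
Qed.

(** The right-hand side bounds the angle by its tangent after a rotation by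
    [PI / 4]. *)
Lemma atan_le_PI4 x : 1 <= x -> atan x <= PI / 4 + (x - 1) / (x + 1).
Proof.
intros hx.
cut ((1 - 1) / (1 + 1) - atan 1 <= (x - 1) / (x + 1) - atan x); [rewrite atan_1; lra |].
apply (derive_nonneg_le (fun t => (t - 1) / (t + 1) - atan t) (fun t => (t - 1) ^ 2 / ((1 + t ^ 2) * (t + 1) ^ 2))); auto.
- intros t ht; auto_derive; [lra | unfold Rsqr; field; split; nra].
- intros t ht; apply Rmult_le_pos; [nra | left; apply Rinv_0_lt_compat; nra].
Qed.

(** The starting point [w = 6 / 5], that is [z = 36 / 25], lies before every
    zero of [u], [v] and their derivatives on the negative axis, so the
    quadrants of the two angles there are known; it is rational, and far
    enough out for [phase_bounds] to be precise. *)
Lemma phase_start Y Y1 : oscillator Y Y1 -> (forall z, Y z = 0 -> Y1 z = 0 -> False) ->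
  0 < Y (36 / 25) ->
  let x := Y1 (36 / 25) / (6 / 5 * Y (36 / 25)) in
  exists phi rho, phase_of Y Y1 phi rho /\ phi (6 / 5) = PI / 2 - atan x.
Proof.
intros hY hn hp x.
assert (sq : 0 < sqrt (1 + x ^ 2)) by (apply sqrt_lt_R0; nra).
destruct (phase_exists Y Y1 (6 / 5) (PI / 2 - atan x) (6 / 5 * Y (36 / 25) * sqrt (1 + x ^ 2)) hY hn)
  as [phi [rho [e h]]].
- lra.
- apply Rmult_lt_0_compat; lra.
- replace ((6 / 5) ^ 2) with (36 / 25) by field.
  rewrite sin_shift, cos_atan; unfold Rsqr; replace (1 + x * x) with (1 + x ^ 2) by ring; field; lra.
- replace ((6 / 5) ^ 2) with (36 / 25) by field.
  rewrite cos_shift, sin_atan; unfold Rsqr; replace (1 + x * x) with (1 + x ^ 2) by ring.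
  transitivity (6 / 5 * Y (36 / 25) * x); [unfold x; field; lra | field; lra].
- exists phi, rho; auto.
Qed.

Section Reflected.
Variables u u1 v v1 : R -> R.
Hypothesis hf : fundamental u u1 v v1.

Lemma reflected_u : oscillator (fun z => u (- z)) (fun z => - u1 (- z)).
Proof.
pose proof (airy_derive _ _ (fund_u _ _ _ _ hf)) as a0.
pose proof (airy_derive_slope _ _ (fund_u _ _ _ _ hf)) as a1.
intros z; split; auto_derive; try (repeat split; eexists; eauto).
- use_derive a0; ring.
- use_derive a1; ring.
Qed.

Lemma reflected_v : oscillator (fun z => - v (- z)) (fun z => v1 (- z)).
Proof.
pose proof (airy_derive _ _ (fund_v _ _ _ _ hf)) as a0.
pose proof (airy_derive_slope _ _ (fund_v _ _ _ _ hf)) as a1.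
intros z; split; auto_derive; try (repeat split; eexists; eauto).
- use_derive a0; ring.
- use_derive a1; ring.
Qed.

Lemma u_taylor t : 0 <= t <= 36 / 25 ->
  Rabs (u (- t) - taylor_short 1 0 t) <= 2 / 180 * t ^ 6 /\
  Rabs (u (- t) - taylor_long 1 0 t) <= 2 / 1710720 * t ^ 12 /\
  Rabs (- u1 (- t) - taylor_long' 1 0 t) <= 2 / 142560 * t ^ 11.
Proof.
intros ht.
assert (h := oscillator_taylor _ _ reflected_u t ht); cbv beta zeta in h.
rewrite Ropp_0, (fund_u0 _ _ _ _ hf), (fund_u10 _ _ _ _ hf), Ropp_0, Rabs_R1, Rabs_R0 in h.
replace (2 * 1 + 3 * 0) with 2 in h by ring; exact h.
Qed.

Lemma v_taylor t : 0 <= t <= 36 / 25 ->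
  Rabs (- v (- t) - taylor_short 0 1 t) <= 3 / 180 * t ^ 6 /\
  Rabs (- v (- t) - taylor_long 0 1 t) <= 3 / 1710720 * t ^ 12 /\
  Rabs (v1 (- t) - taylor_long' 0 1 t) <= 3 / 142560 * t ^ 11.
Proof.
intros ht.
assert (h := oscillator_taylor _ _ reflected_v t ht); cbv beta zeta in h.
rewrite Ropp_0, (fund_v0 _ _ _ _ hf), (fund_v10 _ _ _ _ hf), Ropp_0, Rabs_R1, Rabs_R0 in h.
replace (2 * 0 + 3 * 1) with 3 in h by ring; exact h.
Qed.

Lemma u_start_values : 0.5497 <= u (- (36 / 25)) <= 0.551 /\ 0.842 <= u1 (- (36 / 25)) <= 0.84403.
Proof.
destruct (u_taylor (36 / 25)) as [_ [h1 h2]]; [lra |].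
unfold taylor_long in h1; unfold taylor_long' in h2.
apply Rabs_le_between in h1; apply Rabs_le_between in h2; lra.
Qed.

Lemma v_start_values : 1.105 <= - v (- (36 / 25)) <= 1.107 /\ 0.12 <= v1 (- (36 / 25)) <= 0.125.
Proof.
destruct (v_taylor (36 / 25)) as [_ [h1 h2]]; [lra |].
unfold taylor_long in h1; unfold taylor_long' in h2.
apply Rabs_le_between in h1; apply Rabs_le_between in h2; lra.
Qed.

(** The short Taylor polynomials dominate their error terms for [u] and [v],
    and then [y'' = x y] makes the derivatives monotone. *)
Lemma no_early_zeros t : 0 < t <= 36 / 25 ->
  0 < u (- t) /\ 0 < u1 (- t) /\ v (- t) < 0 /\ 0 < v1 (- t).
Proof.
assert (hu : forall t, 0 < t <= 36 / 25 -> 0 < u (- t)).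
{ intros s hs; destruct (u_taylor s) as [h _]; [lra |].
  unfold taylor_short in h; apply Rabs_le_between in h.
  assert (s ^ 3 <= (36 / 25) ^ 3) by (apply pow_incr; lra).
  assert (s ^ 6 <= (36 / 25) ^ 6) by (apply pow_incr; lra).
  lra. }
assert (hv : forall t, 0 < t <= 36 / 25 -> 0 < - v (- t)).
{ intros s hs; destruct (v_taylor s) as [h _]; [lra |].
  unfold taylor_short in h; apply Rabs_le_between in h.
  assert (s ^ 3 <= (36 / 25) ^ 3) by (apply pow_incr; lra).
  assert (s ^ 5 <= (36 / 25) ^ 5) by (apply pow_incr; lra).
  assert (0 < s * (1 - s ^ 3 / 12 - s ^ 5 / 60)) by (apply Rmult_lt_0_compat; lra).
  lra. }
intros ht; split; [auto | split; [ | split]].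
- cut (- u1 (- t) < - u1 (- 0)); [rewrite Ropp_0, (fund_u10 _ _ _ _ hf); lra |].
  cut (- - u1 (- 0) < - - u1 (- t)); [lra |].
  apply (derive_pos_lt (fun t => - - u1 (- t)) (fun t => t * u (- t))); [lra | |].
  + intros s hs; destruct (reflected_u s) as [_ h].
    replace (s * u (- s)) with (opp (- s * u (- s))) by (unfold opp; simpl; ring).
    apply (is_derive_opp (fun t => - u1 (- t)) s _ h).
  + intros s hs; apply Rmult_lt_0_compat; [lra | apply hu; lra].
- specialize (hv t ht); lra.
- apply Rlt_le_trans with (v1 (- (36 / 25))); [pose proof v_start_values; lra |].
  cut (- v1 (- t) <= - v1 (- (36 / 25))); [lra |].
  apply (derive_nonneg_le (fun t => - v1 (- t)) (fun t => t * - v (- t))); [lra | |].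
  + intros s hs; destruct (reflected_v s) as [_ h].
    replace (s * - v (- s)) with (opp (- s * - v (- s))) by (unfold opp; simpl; ring).
    apply (is_derive_opp (fun t => v1 (- t)) s _ h).
  + intros s hs; apply Rmult_le_pos; [lra | left; apply hv; lra].
Qed.

Lemma sin_atan2 x : sin (atan x) ^ 2 = x ^ 2 / (1 + x ^ 2).
Proof.
rewrite sin_atan; unfold Rsqr; replace (1 + x * x) with (1 + x ^ 2) by ring.
assert (0 < 1 + x ^ 2) by nra.
assert (0 < sqrt (1 + x ^ 2)) by (apply sqrt_lt_R0; auto).
replace (x ^ 2 / (1 + x ^ 2)) with (x ^ 2 / (sqrt (1 + x ^ 2) ^ 2)) by (rewrite pow2_sqrt; lra).
field; lra.
Qed.

(** The deviation from [2 / 3 * w ^ 3] tends to [PI / 12] for [v] and to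
    [5 PI / 12] for [u]; windows around these limits are enough in the
    sequel. *)
Lemma phase_v : exists phi rho, phase_of (fun z => - v (- z)) (fun z => v1 (- z)) phi rho /\
  0 < phi (6 / 5) < PI / 2 /\
  forall w, 6 / 5 <= w -> PI / 2 - 1.392 <= phi w - 2 / 3 * w ^ 3 <= PI / 2 - 1.15.
Proof.
destruct v_start_values as [n0 n1].
destruct (phase_start _ _ reflected_v) as [phi [rho [hp e]]].
- intros z e0 e1; pose proof (fund_wronskian _ _ _ _ (- z) hf) as w.
  replace (v (- z)) with 0 in w by lra; rewrite e1 in w; lra.
- lra.
- exists phi, rho; split; auto.
  set (x := v1 (- (36 / 25)) / (6 / 5 * - v (- (36 / 25)))) in *.
  assert (hx0 : 0 < x) by (apply Rdiv_lt_0_compat; lra).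
  assert (hx1 : x <= 0.095).
  { unfold x; apply div_le; [lra |]. lra. }
  assert (ha := atan_le_id x ltac:(lra)).
  assert (ha0 : 0 < atan x) by (rewrite <- atan_0; apply atan_increasing; auto).
  pose proof PI_bounds.
  split; [lra | intros w hw].
  destruct (phase_bounds _ _ _ _ (6 / 5) w hp) as [b1 b2]; [lra | auto |].
  assert (hc : cos (phi (6 / 5)) ^ 2 <= 0.0091).
  { rewrite e, cos_shift, sin_atan2.
    apply div_le; [nra |]. nra. }
  assert (hs : sin (phi (6 / 5)) ^ 2 <= 1).
  { assert (sc := sin2_cos2 (phi (6 / 5))); unfold Rsqr in sc; nra. }
  lra.
Qed.

Lemma phase_u : exists phi rho, phase_of (fun z => u (- z)) (fun z => - u1 (- z)) phi rho /\
  PI / 2 < phi (6 / 5) < PI /\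
  forall w, 6 / 5 <= w -> 3 * PI / 4 - 1.225 <= phi w - 2 / 3 * w ^ 3 <= 3 * PI / 4 - 0.939.
Proof.
destruct u_start_values as [n0 n1].
destruct (phase_start _ _ reflected_u) as [phi [rho [hp e]]].
- intros z e0 e1; pose proof (fund_wronskian _ _ _ _ (- z) hf) as w.
  replace (u1 (- z)) with 0 in w by lra; rewrite e0 in w; lra.
- lra.
- exists phi, rho; split; auto.
  set (x := u1 (- (36 / 25)) / (6 / 5 * u (- (36 / 25)))).
  assert (e' : phi (6 / 5) = PI / 2 + atan x).
  { rewrite e; replace (- u1 (- (36 / 25)) / (6 / 5 * u (- (36 / 25)))) with (- x) by (unfold x; field; lra).
    rewrite atan_opp; ring. }
  clear e; rename e' into e.
  assert (hx0 : 1 <= x).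
  { unfold x; apply le_div; [lra |]. lra. }
  assert (hx1 : x <= 1.2796).
  { unfold x; apply div_le; [lra |]. lra. }
  assert (ha := atan_le_PI4 x ltac:(lra)).
  assert (hr : (x - 1) / (x + 1) <= 0.1227).
  { apply div_le; [lra |]. lra. }
  assert (ha0 : PI / 4 <= atan x).
  { rewrite <- atan_1; destruct hx0 as [hx0 | <-]; [left; apply atan_increasing; auto | lra]. }
  pose proof PI_bounds.
  split; [lra | intros w hw].
  destruct (phase_bounds _ _ _ _ (6 / 5) w hp) as [b1 b2]; [lra | auto |].
  assert (hc' : cos (phi (6 / 5)) ^ 2 = x ^ 2 / (1 + x ^ 2)).
  { rewrite e; replace (PI / 2 + atan x) with (PI / 2 - - atan x) by ring.
    rewrite cos_shift, sin_neg, <- sin_atan2; ring. }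
  assert (hc : 1 / 2 <= cos (phi (6 / 5)) ^ 2 <= 0.621).
  { rewrite hc'; split; [apply le_div | apply div_le]; nra. }
  assert (hs : sin (phi (6 / 5)) ^ 2 <= 1 / 2).
  { assert (sc := sin2_cos2 (phi (6 / 5))); unfold Rsqr in sc; nra. }
  lra.
Qed.
End Reflected.

(** * Location of the zeroes *)
Lemma increasing_lt (a : nat -> R) : (forall j, a j < a (S j)) ->
  forall i j, (i < j)%nat -> a i < a j.
Proof.
intros h i j hij; induction hij as [ | j hij IH]; auto.
apply Rlt_trans with (a j); auto.
Qed.

(** Of two first differing terms the smaller one would be missing from the
    other sequence. *)
Lemma increasing_same_range (a b : nat -> R) :
  (forall j, a j < a (S j)) -> (forall j, b j < b (S j)) ->
  (forall j, exists i, b i = a j) -> (forall j, exists i, a i = b j) ->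
  forall j, a j = b j.
Proof.
intros ha hb hab hba j.
induction j as [j IH] using (well_founded_induction Wf_nat.lt_wf).
assert (la := increasing_lt a ha); assert (lb := increasing_lt b hb).
destruct (hab j) as [i ei]; destruct (hba j) as [k ek].
destruct (Nat.lt_total i j) as [h | [-> | h]]; auto.
{ specialize (IH i h); specialize (la i j h); lra. }
destruct (Nat.lt_total k j) as [h' | [-> | h']]; auto.
{ specialize (IH k h'); specialize (lb k j h'); lra. }
specialize (lb _ _ h); specialize (la _ _ h'); lra.
Qed.

Lemma sin_zero_nat y : - PI < y -> (sin y = 0 <-> exists j : nat, y = INR j * PI).
Proof.
intros hy; pose proof PI_RGT_0; split.
- intros e; destruct (sin_eq_0_0 y e) as [k hk].
  assert (0 <= k)%Z.
  { apply Z.lt_succ_r; apply lt_IZR; rewrite succ_IZR.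
    assert (-1 < IZR k); [ | lra].
    apply Rmult_lt_reg_r with PI; auto; lra. }
  exists (Z.to_nat k); rewrite INR_IZR_INZ, Z2Nat.id; auto.
- intros [j ->]; apply sin_eq_0_1; exists (Z.of_nat j); now rewrite <- INR_IZR_INZ.
Qed.

(** The angle maps the zeroes beyond the starting point increasingly onto the
    [beta + j PI], so the enumeration of the zeroes has to follow [j]. *)
Lemma enumerated_phase (Z : R -> Prop) (d : nat -> R) Y Y1 phi rho beta :
  phase_of Y Y1 phi rho ->
  enumerates_decreasing (fun j => - d j) Z ->
  (forall x, Z x -> x < - (36 / 25)) ->
  (forall w, 6 / 5 < w -> (Z (- w ^ 2) <-> sin (phi w - beta) = 0)) ->
  beta - PI < phi (6 / 5) < beta ->
  forall j, 36 / 25 < d j /\ phi (sqrt (d j)) = beta + INR j * PI.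
Proof.
intros hp [hdec hZ] hearly hsin hb.
pose proof PI_RGT_0.
assert (dpos : forall j, 36 / 25 < d j).
{ intros j; cut (- d j < - (36 / 25)); [lra | apply hearly, hZ; exists j; auto]. }
assert (wpos : forall j, 6 / 5 < sqrt (d j)).
{ intros j; replace (6 / 5) with (sqrt (36 / 25)).
  - apply sqrt_lt_1; specialize (dpos j); lra.
  - replace (36 / 25) with ((6 / 5) * (6 / 5)) by field; apply sqrt_square; lra. }
assert (wsq : forall j, sqrt (d j) ^ 2 = d j).
{ intros j; apply pow2_sqrt; specialize (dpos j); lra. }
assert (mono := fun w w' => phase_increasing _ _ _ _ w w' hp).
intros j; split; auto.
apply (increasing_same_range (fun j => phi (sqrt (d j))) (fun j => beta + INR j * PI)).
- intros i; apply mono; [specialize (wpos i); lra |].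
  apply sqrt_lt_1; pose proof (dpos i); pose proof (dpos (S i)); pose proof (hdec i); lra.
- intros i; rewrite S_INR; lra.
- intros i.
  assert (e : sin (phi (sqrt (d i)) - beta) = 0).
  { apply hsin; auto; rewrite wsq; apply hZ; exists i; auto. }
  apply sin_zero_nat in e.
  + destruct e as [k hk]; exists k; lra.
  + assert (phi (6 / 5) < phi (sqrt (d i))) by (apply mono; [lra | auto]); lra.
- intros i.
  destruct (phase_surjective _ _ _ _ (6 / 5) (beta + INR i * PI) hp) as [w [hw e]]; [lra | |].
  + assert (0 <= INR i * PI) by (apply Rmult_le_pos; [apply pos_INR | lra]); lra.
  + assert (hz : Z (- w ^ 2)).
    { apply hsin; auto; rewrite e; apply sin_zero_nat; [ | exists i; ring].
      assert (0 <= INR i * PI) by (apply Rmult_le_pos; [apply pos_INR | lra]); lra. }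
    apply hZ in hz; destruct hz as [k hk]; exists k.
    replace (d k) with (w * w) by lra; rewrite sqrt_square; lra.
Qed.

(** The leading term of the angle at [z = x]. *)
Definition zeta (x : R) : R := 2 / 3 * sqrt x ^ 3.

(** The left end of the interval that contains band [p]: the zero of index
    [p - 1] of the second family, with [0] for [p = 0]. *)
Definition prev_end (ct : nat -> R) (p : nat) : R :=
  match p with O => 0 | S q => ct q end.

(** Products of the two [left_data] have the sign of [v' u'] or [v u] at
    [- z]; [zl_band] and [zl_gap] say where each parity can have eigenvalues:
    band [p] only admits the parity of [p], and there is none between [c p]
    and [ct p]. *)
Record zeros_located (u u1 v v1 : R -> R) (c ct : nat -> R) : Prop := {
  zl_early : forall p, 36 / 25 < c p /\ 36 / 25 < ct p;
  zl_c : forall p, PI / 2 - 1.392 <= (INR p + 1) * (PI / 2) - zeta (c p) <= PI / 2 - 1.15;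
  zl_ct : forall p, 3 * PI / 4 - 1.225 <= (INR p + 2) * (PI / 2) - zeta (ct p) <= 3 * PI / 4 - 0.939;
  zl_lt : forall p, c p < ct p < c (S p);
  zl_left : forall p, left_data u u1 (Nat.odd p) (prev_end ct p) = 0;
  zl_right : forall p, left_data v v1 (Nat.odd p) (c p) = 0;
  zl_complete : forall z, 0 < z -> v (- z) = 0 \/ v1 (- z) = 0 -> exists p, z = c p;
  zl_band : forall p z, prev_end ct p < z < c p ->
     0 < left_data v v1 (Nat.odd p) z * left_data u u1 (Nat.odd p) z /\
     left_data v v1 (negb (Nat.odd p)) z * left_data u u1 (negb (Nat.odd p)) z < 0;
  zl_gap : forall p o z, c p <= z <= ct p -> left_data v v1 o z * left_data u u1 o z <= 0 }.

Lemma zeta_lt x y : 0 <= x -> 0 <= y -> zeta x < zeta y -> x < y.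
Proof.
intros hx hy h; destruct (Rlt_le_dec x y) as [l | l]; auto; exfalso.
assert (sqrt y <= sqrt x) by (apply sqrt_le_1; auto).
assert (sqrt y ^ 3 <= sqrt x ^ 3) by (apply pow_incr; split; auto; apply sqrt_pos).
unfold zeta in h; lra.
Qed.

(** Products of two sines or of two cosines do not see a common shift by a
    multiple of [PI], so quadrants can be treated modulo [2]. *)
Lemma trig_product_shift m x y :
  sin (x + INR m * PI) * sin (y + INR m * PI) = sin x * sin y /\
  cos (x + INR m * PI) * cos (y + INR m * PI) = cos x * cos y.
Proof.
induction m as [ | m [IHs IHc]].
- simpl; rewrite Rmult_0_l, !Rplus_0_r; auto.
- rewrite S_INR.
  replace (x + (INR m + 1) * PI) with (x + INR m * PI + PI) by ring.
  replace (y + (INR m + 1) * PI) with (y + INR m * PI + PI) by ring.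
  rewrite !neg_sin, !neg_cos, <- IHs, <- IHc; split; ring.
Qed.

Lemma same_quadrant n x y :
  INR n * (PI / 2) <= x <= (INR n + 1) * (PI / 2) ->
  INR n * (PI / 2) <= y <= (INR n + 1) * (PI / 2) ->
  0 <= sin x * sin y /\ 0 <= cos x * cos y.
Proof.
pose proof PI_RGT_0.
intros hx hy; destruct (Nat.Even_or_Odd n) as [[m ->] | [m ->]].
- rewrite mult_INR in hx, hy; simpl INR in hx, hy.
  destruct (trig_product_shift m (x - INR m * PI) (y - INR m * PI)) as [es ec].
  replace (x - INR m * PI + INR m * PI) with x in * by ring.
  replace (y - INR m * PI + INR m * PI) with y in * by ring.
  rewrite es, ec; split; apply Rmult_le_pos; (apply sin_ge_0 || apply cos_ge_0); lra.
- rewrite plus_INR, mult_INR in hx, hy; simpl INR in hx, hy.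
  destruct (trig_product_shift m (x - INR m * PI) (y - INR m * PI)) as [es ec].
  replace (x - INR m * PI + INR m * PI) with x in * by ring.
  replace (y - INR m * PI + INR m * PI) with y in * by ring.
  rewrite es, ec; split.
  + apply Rmult_le_pos; apply sin_ge_0; lra.
  + assert (cos (x - INR m * PI) <= 0) by (apply cos_le_0; lra).
    assert (cos (y - INR m * PI) <= 0) by (apply cos_le_0; lra). nra.
Qed.

Lemma next_quadrant n x y :
  INR n * (PI / 2) < x < (INR n + 1) * (PI / 2) ->
  (INR n + 1) * (PI / 2) < y < (INR n + 2) * (PI / 2) ->
  if Nat.odd n then sin x * sin y < 0 /\ 0 < cos x * cos y
  else cos x * cos y < 0 /\ 0 < sin x * sin y.
Proof.
pose proof PI_RGT_0.
intros hx hy; destruct (Nat.Even_or_Odd n) as [[m ->] | [m ->]].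
- rewrite Nat.odd_even.
  rewrite mult_INR in hx, hy; simpl INR in hx, hy.
  destruct (trig_product_shift m (x - INR m * PI) (y - INR m * PI)) as [es ec].
  replace (x - INR m * PI + INR m * PI) with x in * by ring.
  replace (y - INR m * PI + INR m * PI) with y in * by ring.
  rewrite es, ec.
  assert (0 < cos (x - INR m * PI)) by (apply cos_gt_0; lra).
  assert (cos (y - INR m * PI) < 0) by (apply cos_lt_0; lra).
  assert (0 < sin (x - INR m * PI)) by (apply sin_gt_0; lra).
  assert (0 < sin (y - INR m * PI)) by (apply sin_gt_0; lra). split; nra.
- rewrite Nat.odd_odd.
  rewrite plus_INR, mult_INR in hx, hy; simpl INR in hx, hy.
  destruct (trig_product_shift m (x - INR m * PI) (y - INR m * PI)) as [es ec].
  replace (x - INR m * PI + INR m * PI) with x in * by ring.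
  replace (y - INR m * PI + INR m * PI) with y in * by ring.
  rewrite es, ec.
  assert (0 < sin (x - INR m * PI)) by (apply sin_gt_0; lra).
  assert (sin (y - INR m * PI) < 0) by (apply sin_lt_0; lra).
  assert (cos (x - INR m * PI) < 0) by (apply cos_lt_0; lra).
  assert (cos (y - INR m * PI) < 0) by (apply cos_lt_0; lra). split; nra.
Qed.

Section Located.
Variables (u u1 v v1 : R -> R) (c ct : nat -> R).
Hypothesis hf : fundamental u u1 v v1.
Hypothesis hc_even : enumerates_decreasing (fun j => - c (2 * j)%nat) (fun x => v1 x = 0).
Hypothesis hc_odd : enumerates_decreasing (fun j => - c (2 * j + 1)%nat) (fun x => x <> 0 /\ v x = 0).
Hypothesis hct_even : enumerates_decreasing (fun j => - ct (2 * j)%nat) (fun x => u x = 0).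
Hypothesis hct_odd : enumerates_decreasing (fun j => - ct (2 * j + 1)%nat) (fun x => x <> 0 /\ u1 x = 0).

Lemma zeros_far x : x <> 0 -> u x = 0 \/ u1 x = 0 \/ v x = 0 \/ v1 x = 0 -> x < - (36 / 25).
Proof.
intros h0 hz.
destruct (Rlt_le_dec x (- (36 / 25))) as [h | h]; auto; exfalso.
destruct (Rtotal_order x 0) as [hx | [hx | hx]]; auto.
- destruct (no_early_zeros _ _ _ _ hf (- x)) as (?&?&?&?); [lra |].
  rewrite Ropp_involutive in *; lra.
- destruct (fund_pos _ _ _ _ x hf hx) as (?&?&?&?); lra.
Qed.

Lemma c_phase phi rho : phase_of (fun z => - v (- z)) (fun z => v1 (- z)) phi rho ->
  0 < phi (6 / 5) < PI / 2 ->
  forall p, 36 / 25 < c p /\ phi (sqrt (c p)) = (INR p + 1) * (PI / 2).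
Proof.
intros hp h0 p; pose proof PI_RGT_0.
destruct (Nat.Even_or_Odd p) as [[j ->] | [j ->]].
- destruct (enumerated_phase _ (fun j => c (2 * j)%nat) _ _ phi rho (PI / 2) hp hc_even) with (j := j) as [h1 h2].
  + intros x hx; apply zeros_far; auto.
    intros ->; rewrite (fund_v10 _ _ _ _ hf) in hx; lra.
  + intros w hw; destruct (hp w) as (r & _ & e & _); [lra |]; simpl in e.
    replace (sin (phi w - PI / 2)) with (- cos (phi w)) by (rewrite <- sin_shift, <- sin_neg; f_equal; ring).
    simpl; rewrite e; split; intros h; [assert (cos (phi w) = 0) by nra; lra | assert (cos (phi w) = 0) as -> by lra; ring].
  + lra.
  + split; auto; rewrite h2, mult_INR; simpl; field.
- destruct (enumerated_phase _ (fun j => c (2 * j + 1)%nat) _ _ phi rho PI hp hc_odd) with (j := j) as [h1 h2].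
  + intros x [hx hx']; apply zeros_far; auto.
  + intros w hw; destruct (hp w) as (r & e & _ & _); [lra |]; simpl in e.
    replace (sin (phi w - PI)) with (- sin (phi w)).
    2:{ rewrite <- neg_sin, <- (sin_period (phi w - PI) 1); f_equal; simpl; ring. }
    split.
    * intros [_ h]; simpl in h; rewrite h in e; nra.
    * intros h; split; [nra |]. simpl. assert (h' : sin (phi w) = 0) by lra.
      rewrite h' in e; nra.
  + lra.
  + split; auto; rewrite h2, plus_INR, mult_INR; simpl; field.
Qed.

Lemma ct_phase phi rho : phase_of (fun z => u (- z)) (fun z => - u1 (- z)) phi rho ->
  PI / 2 < phi (6 / 5) < PI ->
  forall p, 36 / 25 < ct p /\ phi (sqrt (ct p)) = (INR p + 2) * (PI / 2).
Proof.
intros hp h0 p; pose proof PI_RGT_0.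
destruct (Nat.Even_or_Odd p) as [[j ->] | [j ->]].
- destruct (enumerated_phase _ (fun j => ct (2 * j)%nat) _ _ phi rho PI hp hct_even) with (j := j) as [h1 h2].
  + intros x hx; apply zeros_far; auto.
    intros ->; rewrite (fund_u0 _ _ _ _ hf) in hx; lra.
  + intros w hw; destruct (hp w) as (r & e & _ & _); [lra |]; simpl in e.
    replace (sin (phi w - PI)) with (- sin (phi w)).
    2:{ rewrite <- neg_sin, <- (sin_period (phi w - PI) 1); f_equal; simpl; ring. }
    split.
    * intros h; simpl in h; rewrite h in e; nra.
    * intros h; simpl. assert (h' : sin (phi w) = 0) by lra.
      rewrite h' in e; nra.
  + lra.
  + split; auto; rewrite h2, mult_INR; simpl; field.
- destruct (enumerated_phase _ (fun j => ct (2 * j + 1)%nat) _ _ phi rho (3 * (PI / 2)) hp hct_odd) with (j := j) as [h1 h2].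
  + intros x [hx hx']; apply zeros_far; auto.
  + intros w hw; destruct (hp w) as (r & _ & e & _); [lra |]; simpl in e.
    replace (sin (phi w - 3 * (PI / 2))) with (cos (phi w)).
    2:{ rewrite <- sin_shift, <- (sin_period (phi w - 3 * (PI / 2)) 1), <- (Ropp_involutive (sin (PI / 2 - phi w))), <- sin_neg, <- neg_sin.
        f_equal; simpl; field. }
    split.
    * intros [_ h]; simpl in h; rewrite h in e; nra.
    * intros h; split; [nra |]. simpl.
      rewrite h in e; nra.
  + lra.
  + split; auto; rewrite h2, plus_INR, mult_INR; simpl; field.
Qed.

(** In band [p] the angle of [v] is in quadrant [p] and that of [u] in the
    next one; between [c p] and [ct p] both are in quadrant [p + 1]. *)
Lemma zeros_location : zeros_located u u1 v v1 c ct.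
Proof.
pose proof PI_bounds as hpi.
destruct (phase_v _ _ _ _ hf) as [pv [rv [hv [v0 vb]]]].
destruct (phase_u _ _ _ _ hf) as [pu [ru [hu [u0 ub]]]].
assert (hc := c_phase pv rv hv v0).
assert (hct := ct_phase pu ru hu u0).
assert (sq65 : sqrt (36 / 25) = 6 / 5).
{ replace (36 / 25) with ((6 / 5) * (6 / 5)) by field; apply sqrt_square; lra. }
assert (sq : forall x, 36 / 25 < x -> 6 / 5 < sqrt x).
{ intros x hx; rewrite <- sq65; apply sqrt_lt_1; lra. }
assert (early : forall p, 36 / 25 < c p /\ 36 / 25 < ct p).
{ intros p; split; [apply hc | apply hct]. }
assert (bc : forall p, PI / 2 - 1.392 <= (INR p + 1) * (PI / 2) - zeta (c p) <= PI / 2 - 1.15).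
{ intros p; destruct (hc p) as [h1 h2]; rewrite <- h2; apply vb; left; apply sq; auto. }
assert (bct : forall p, 3 * PI / 4 - 1.225 <= (INR p + 2) * (PI / 2) - zeta (ct p) <= 3 * PI / 4 - 0.939).
{ intros p; destruct (hct p) as [h1 h2]; rewrite <- h2; apply ub; left; apply sq; auto. }
assert (lt : forall p, c p < ct p < c (S p)).
{ intros p; destruct (early p); destruct (early (S p)).
  specialize (bct p); assert (b1 := bc p); assert (b2 := bc (S p)); rewrite S_INR in b2.
  split; apply zeta_lt; lra. }
assert (sqm : forall x y, 0 <= x -> x < y -> sqrt x < sqrt y) by (intros; apply sqrt_lt_1; lra).
assert (mv := fun w w' => phase_increasing _ _ _ _ w w' hv).
assert (mu := fun w w' => phase_increasing _ _ _ _ w w' hu).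
assert (prods : forall z, 36 / 25 <= z ->
   (exists k, 0 < k /\ v (- z) * u (- z) = - k * (sin (pv (sqrt z)) * sin (pu (sqrt z)))) /\
   (exists k, 0 < k /\ v1 (- z) * u1 (- z) = - k * (cos (pv (sqrt z)) * cos (pu (sqrt z))))).
{ intros z hz.
  assert (hw : 0 < sqrt z) by (apply sqrt_lt_R0; lra).
  assert (e : sqrt z ^ 2 = z) by (apply pow2_sqrt; lra).
  destruct (hv (sqrt z) hw) as (r1 & s1 & t1 & _).
  destruct (hu (sqrt z) hw) as (r2 & s2 & t2 & _).
  cbv beta in s1, t1, s2, t2; rewrite e in s1, t1, s2, t2.
  assert (rr : 0 < rv (sqrt z) * ru (sqrt z)) by (apply Rmult_lt_0_compat; auto).
  split.
  - exists (rv (sqrt z) * ru (sqrt z) / z); split; [apply Rdiv_lt_0_compat; lra |].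
    replace (rv (sqrt z) * ru (sqrt z) / z) with (rv (sqrt z) * ru (sqrt z) / sqrt z ^ 2) by (rewrite e; auto).
    replace (v (- z)) with (- (rv (sqrt z) * sin (pv (sqrt z)) / sqrt z)) by (rewrite <- s1; field; lra).
    replace (u (- z)) with (ru (sqrt z) * sin (pu (sqrt z)) / sqrt z) by (rewrite <- s2; field; lra).
    field; lra.
  - exists (rv (sqrt z) * ru (sqrt z)); split; auto.
    replace (u1 (- z)) with (- (ru (sqrt z) * cos (pu (sqrt z)))) by lra.
    rewrite t1; ring. }
constructor; auto.
- intros [ | p].
  + simpl; unfold left_data; rewrite Ropp_0; apply (fund_u10 _ _ _ _ hf).
  + simpl prev_end.
    destruct (Nat.Even_or_Odd p) as [[j ->] | [j ->]].
    * replace (Nat.odd (S (2 * j))) with true by (symmetry; apply Nat.odd_spec; exists j; lia).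
      apply (proj2 hct_even); exists j; auto.
    * replace (Nat.odd (S (2 * j + 1))) with false.
      2:{ rewrite Nat.odd_succ; symmetry; apply Bool.not_true_iff_false; rewrite Nat.even_spec; intros [k hk]; lia. }
      apply (proj2 hct_odd); exists j; auto.
- intros p; destruct (Nat.Even_or_Odd p) as [[j ->] | [j ->]].
  + rewrite Nat.odd_even; apply (proj2 hc_even); exists j; auto.
  + rewrite Nat.odd_odd; apply (proj2 hc_odd); exists j; auto.
- intros z hz [h | h].
  + destruct (proj1 (proj2 hc_odd (- z))) as [j hj]; [split; auto; lra | exists (2 * j + 1)%nat; lra].
  + destruct (proj1 (proj2 hc_even (- z)) h) as [j hj]; exists (2 * j)%nat; lra.
- intros p z hz.
  destruct (Rlt_le_dec (36 / 25) z) as [hz' | hz'].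
  + assert (hw := sq z hz').
    assert (qv : INR p * (PI / 2) < pv (sqrt z) < (INR p + 1) * (PI / 2)).
    { split.
      - destruct p as [ | p]; [simpl; rewrite Rmult_0_l; assert (pv (6 / 5) < pv (sqrt z)) by (apply mv; lra); lra |].
        rewrite S_INR, <- (proj2 (hc p)); simpl in hz; destruct (lt p); destruct (early p).
        apply mv; [assert (6 / 5 < sqrt (c p)) by auto; lra | apply sqm; lra].
      - rewrite <- (proj2 (hc p)); apply mv; [lra | apply sqm; lra]. }
    assert (qu : (INR p + 1) * (PI / 2) < pu (sqrt z) < (INR p + 2) * (PI / 2)).
    { split.
      - destruct p as [ | p]; [simpl; assert (pu (6 / 5) < pu (sqrt z)) by (apply mu; lra); lra |].
        rewrite S_INR; replace (INR p + 1 + 1) with (INR p + 2) by ring; rewrite <- (proj2 (hct p)); simpl in hz.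
        destruct (early p).
        apply mu; [assert (6 / 5 < sqrt (ct p)) by auto; lra | apply sqm; lra].
      - rewrite <- (proj2 (hct p)); apply mu; [lra | apply sqm; try lra; destruct (lt p); lra]. }
    assert (hq := next_quadrant p _ _ qv qu).
    destruct (prods z) as [[k1 [k1p e1]] [k2 [k2p e2]]]; [lra |].
    unfold left_data; destruct (Nat.odd p); simpl negb; cbv iota; rewrite e1, e2; split; nra.
  + assert (p = O) as ->.
    { destruct p; auto; simpl in hz; destruct (early p); lra. }
    simpl in hz; simpl; unfold left_data.
    destruct (no_early_zeros _ _ _ _ hf z) as (?&?&?&?); [lra |].
    split; nra.
- intros p o z hz.
  destruct (early p) as [ec ect].
  assert (hw := sq z ltac:(lra)).
  assert (le_v : forall x y, 36 / 25 < x -> x <= y -> pv (sqrt x) <= pv (sqrt y)).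
  { intros x y hx [hy | ->]; [left; apply mv; [assert (6 / 5 < sqrt x) by auto; lra | apply sqm; lra] | lra]. }
  assert (le_u : forall x y, 36 / 25 < x -> x <= y -> pu (sqrt x) <= pu (sqrt y)).
  { intros x y hx [hy | ->]; [left; apply mu; [assert (6 / 5 < sqrt x) by auto; lra | apply sqm; lra] | lra]. }
  assert (qv : INR (S p) * (PI / 2) <= pv (sqrt z) <= (INR (S p) + 1) * (PI / 2)).
  { rewrite S_INR; split.
    - rewrite <- (proj2 (hc p)); apply le_v; lra.
    - rewrite <- S_INR, <- (proj2 (hc (S p))); apply le_v; try lra; destruct (lt p); lra. }
  assert (qu : INR (S p) * (PI / 2) <= pu (sqrt z) <= (INR (S p) + 1) * (PI / 2)).
  { rewrite S_INR; split.
    - destruct p as [ | p]; [simpl; assert (pu (6 / 5) < pu (sqrt z)) by (apply mu; lra); lra |].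
      rewrite S_INR; replace (INR p + 1 + 1) with (INR p + 2) by ring; rewrite <- (proj2 (hct p)).
      destruct (early p); destruct (lt p); apply le_u; lra.
    - replace (INR p + 1 + 1) with (INR p + 2) by ring; rewrite <- (proj2 (hct p)); apply le_u; lra. }
  assert (hq := same_quadrant (S p) _ _ qv qu).
  destruct (prods z) as [[k1 [k1p e1]] [k2 [k2p e2]]]; [lra |].
  unfold left_data; destruct o; [rewrite e1 | rewrite e2]; nra.
Qed.
End Located.

(** * Reduction of the eigenvalue problem *)
Lemma Rpower_third_cube x : 0 < x -> Rpower x (1 / 3) ^ 3 = x.
Proof.
intros hx; assert (0 < Rpower x (1 / 3)) by apply exp_pos.
rewrite <- Rpower_pow, Rpower_mult by auto.
replace (1 / 3 * INR 3) with 1 by (simpl; field).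
now apply Rpower_1.
Qed.

(** Eigenfunctions are built by reflecting a solution from the half cell. *)
Lemma glue_derive (f g f' g' : R -> R) :
  (forall x, is_derive f x (f' x)) -> (forall x, is_derive g x (g' x)) ->
  f 0 = g 0 -> f' 0 = g' 0 ->
  forall x, is_derive (fun x => if Rlt_dec x 0 then f x else g x) x
    (if Rlt_dec x 0 then f' x else g' x).
Proof.
intros df dg e0 e1 x.
destruct (Rtotal_order x 0) as [h | [-> | h]].
- destruct (Rlt_dec x 0) as [_ | n]; [ | lra].
  apply (is_derive_ext_loc f); auto.
  assert (hp : 0 < - x) by lra.
  exists (mkposreal _ hp); intros t ht.
  unfold ball in ht; simpl in ht; unfold AbsRing_ball, abs, minus, plus, opp in ht; simpl in ht.
  apply Rabs_def2 in ht; destruct (Rlt_dec t 0); auto; lra.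
- destruct (Rlt_dec 0 0) as [n | _]; [lra |].
  apply is_derive_Reals; intros eps heps.
  specialize (df 0); specialize (dg 0); rewrite e1 in df.
  apply is_derive_Reals in df; apply is_derive_Reals in dg.
  destruct (df eps heps) as [d1 h1]; destruct (dg eps heps) as [d2 h2].
  assert (hd : 0 < Rmin d1 d2) by (apply Rmin_glb_lt; apply cond_pos).
  exists (mkposreal _ hd); intros h hn hh; simpl in hh.
  destruct (Rlt_dec 0 0) as [n | _]; [lra |].
  destruct (Rlt_dec (0 + h) 0).
  + rewrite <- e0; apply h1; auto; apply Rlt_le_trans with (Rmin d1 d2); auto; apply Rmin_l.
  + apply h2; auto; apply Rlt_le_trans with (Rmin d1 d2); auto; apply Rmin_r.
- destruct (Rlt_dec x 0) as [n | _]; [lra |].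
  apply (is_derive_ext_loc g); auto.
  exists (mkposreal _ h); intros t ht.
  unfold ball in ht; simpl in ht; unfold AbsRing_ball, abs, minus, plus, opp in ht; simpl in ht.
  apply Rabs_def2 in ht; destruct (Rlt_dec t 0); auto; lra.
Qed.

Lemma constant_on f b : (forall t, 0 <= t <= b -> is_derive f t 0) ->
  forall x, 0 <= x <= b -> f x = f 0.
Proof.
intros hd x hx; destruct (Req_dec x 0) as [-> | hn]; auto.
destruct (mean_value f (fun _ => 0) 0 x) as [t [_ e]]; [lra | intros; apply hd; lra | lra].
Qed.

Section Reduction.
Variables (u u1 v v1 : R -> R).
Hypothesis hf : fundamental u u1 v v1.

Definition neumann_sol a x := left_sol u u1 v v1 false a x.
Definition neumann_sol1 a x := left_sol1 u u1 v v1 false a x.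
Definition dirichlet_sol a x := - left_sol u u1 v v1 true a x.
Definition dirichlet_sol1 a x := - left_sol1 u u1 v v1 true a x.

Lemma sols_wronskian a x :
  neumann_sol a x * dirichlet_sol1 a x - neumann_sol1 a x * dirichlet_sol a x = 1.
Proof.
unfold neumann_sol, neumann_sol1, dirichlet_sol, dirichlet_sol1, left_sol, left_sol1, left_data.
rewrite <- (fund_wronskian _ _ _ _ (- a) hf) at 1.
rewrite <- (Rmult_1_r (u (- a) * v1 (- a) - _)).
rewrite <- (fund_wronskian _ _ _ _ x hf); ring.
Qed.

Lemma sols_left a : neumann_sol a (- a) = 1 /\ neumann_sol1 a (- a) = 0 /\
  dirichlet_sol a (- a) = 0 /\ dirichlet_sol1 a (- a) = 1.
Proof.
assert (w := fund_wronskian _ _ _ _ (- a) hf).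
unfold neumann_sol, neumann_sol1, dirichlet_sol, dirichlet_sol1, left_sol, left_sol1, left_data; lra.
Qed.

(** The Wronskians of the given solution with the two normalised solutions
    are constant, and the solution is recovered from them. *)
Lemma half_line_solution (f f1 : R -> R) k a b : 0 < k ->
  (forall t, 0 <= t <= b -> is_derive f t (f1 t)) ->
  (forall t, 0 <= t <= b -> is_derive f1 t (k ^ 2 * (k * t - a) * f t)) ->
  forall x, 0 <= x <= b ->
  f x = f 0 * neumann_sol a (k * x - a) + f1 0 / k * dirichlet_sol a (k * x - a) /\
  f1 x = k * f 0 * neumann_sol1 a (k * x - a) + f1 0 * dirichlet_sol1 a (k * x - a).
Proof.
intros hk df df1 x hx.
assert (aN := left_sol_airy u u1 v v1 false a hf).
assert (aD := left_sol_airy u u1 v v1 true a hf).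
assert (n0 := airy_derive _ _ aN); assert (n1 := airy_derive_slope _ _ aN).
assert (d0 := airy_derive _ _ aD); assert (d1 := airy_derive_slope _ _ aD).
set (P := fun x => k * f x * dirichlet_sol1 a (k * x - a) - f1 x * dirichlet_sol a (k * x - a)).
set (Q := fun x => f1 x * neumann_sol a (k * x - a) - k * f x * neumann_sol1 a (k * x - a)).
assert (eP : P x = P 0).
{ apply (constant_on P b); auto; intros t ht; specialize (df t ht); specialize (df1 t ht).
  unfold P, dirichlet_sol, dirichlet_sol1; auto_derive; [repeat split; eexists; eauto |].
  use_derive d0; use_derive d1.
  rewrite (is_derive_unique (fun x : R => f x) _ _ df), (is_derive_unique (fun x : R => f1 x) _ _ df1).
  unfold Rminus; ring. }
assert (eQ : Q x = Q 0).
{ apply (constant_on Q b); auto; intros t ht; specialize (df t ht); specialize (df1 t ht).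
  unfold Q, neumann_sol, neumann_sol1; auto_derive; [repeat split; eexists; eauto |].
  use_derive n0; use_derive n1.
  rewrite (is_derive_unique (fun x : R => f x) _ _ df), (is_derive_unique (fun x : R => f1 x) _ _ df1).
  unfold Rminus; ring. }
destruct (sols_left a) as (l1 & l2 & l3 & l4).
assert (P0 : P 0 = k * f 0).
{ unfold P; replace (k * 0 - a) with (- a) by ring; rewrite l3, l4; ring. }
assert (Q0 : Q 0 = f1 0).
{ unfold Q; replace (k * 0 - a) with (- a) by ring; rewrite l1, l2; ring. }
assert (w := sols_wronskian a (k * x - a)).
rewrite P0 in eP; rewrite Q0 in eQ.
split.
- rewrite <- eQ; apply (Rmult_eq_reg_l k); [ | lra].
  transitivity (k * f 0 * neumann_sol a (k * x - a) + Q x * dirichlet_sol a (k * x - a)); [ | field; lra].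
  rewrite <- eP; unfold P, Q.
  rewrite <- (Rmult_1_r (k * f x)) at 1; rewrite <- w; ring.
- rewrite <- eQ, <- eP; unfold P, Q.
  rewrite <- (Rmult_1_r (f1 x)) at 1; rewrite <- w; ring.
Qed.

Variables hbar m L0 V0 : R.
Hypothesis (hhbar : 0 < hbar) (hm : 0 < m) (hL0 : 0 < L0) (hV0 : 0 < V0).
Variable V : R -> R.
Hypothesis hV : periodic_potential L0 V0 V.
Let th := theta hbar m L0 V0.
Let cc := th * V0.
Let k := cc / L0.

Definition sign_of (b : bool) : R := if b then 1 else -1.

Lemma theta_pos : 0 < th.
Proof. apply exp_pos. Qed.

Lemma theta_cube : th ^ 3 = 2 * m * L0 ^ 2 / (hbar ^ 2 * V0 ^ 2).
Proof.
apply Rpower_third_cube.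
apply Rdiv_lt_0_compat; repeat apply Rmult_lt_0_compat; auto; try lra; apply pow_lt; auto.
Qed.

Lemma k_pos : 0 < k.
Proof. pose proof theta_pos; unfold k, cc; apply Rdiv_lt_0_compat; auto; apply Rmult_lt_0_compat; auto. Qed.

Lemma scaled_equation E x y d2 : - L0 <= x <= L0 ->
  (- (hbar ^ 2 / (2 * m)) * d2 + V x * y = E * y <->
   d2 = k ^ 2 * (k * Rabs x - (cc + th * E)) * y).
Proof.
intros hx; rewrite (proj2 hV x hx).
assert (t3 := theta_cube).
assert (e : k ^ 2 * (k * Rabs x - (cc + th * E)) =
   2 * m / hbar ^ 2 * (V0 * (Rabs x / L0 - 1) - E)).
{ unfold k, cc.
  transitivity (th ^ 3 * (V0 ^ 2 / L0 ^ 2) * (V0 * (Rabs x / L0 - 1) - E)); [field; lra |].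
  rewrite t3; field; lra. }
rewrite e; split; intros h.
- assert (h' : hbar ^ 2 / (2 * m) * d2 = (V0 * (Rabs x / L0 - 1) - E) * y) by lra.
  replace d2 with (2 * m / hbar ^ 2 * (hbar ^ 2 / (2 * m) * d2)) by (field; lra).
  rewrite h'; ring.
- rewrite h; field; lra.
Qed.

Section Energy.
Variables (sb : bool) (E : R).
Let a := cc + th * E.
Let W := eigenspace hbar m L0 V (sign_of sb) E.

Lemma scaled_right_end : k * L0 - a = cc - a.
Proof. unfold k; field; lra. Qed.

(** Both [psi] and its reflection solve the same equation on [[0, L0]]. *)
Lemma eigen_formula psi x : W psi -> 0 <= x <= L0 ->
  psi x = psi 0 * neumann_sol a (k * x - a) + Derive psi 0 / k * dirichlet_sol a (k * x - a) /\
  psi (- x) = psi 0 * neumann_sol a (k * x - a) - Derive psi 0 / k * dirichlet_sol a (k * x - a) /\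
  Derive psi x = k * psi 0 * neumann_sol1 a (k * x - a) + Derive psi 0 * dirichlet_sol1 a (k * x - a) /\
  Derive psi (- x) = - k * psi 0 * neumann_sol1 a (k * x - a) + Derive psi 0 * dirichlet_sol1 a (k * x - a).
Proof.
intros [hd [heq _]] hx.
assert (hk := k_pos).
assert (d0 : forall t, is_derive psi t (Derive psi t)) by (intros t; apply Derive_correct, hd).
assert (d1 : forall t, - L0 <= t <= L0 -> is_derive (Derive psi) t (k ^ 2 * (k * Rabs t - a) * psi t)).
{ intros t ht; specialize (heq t ht); apply scaled_equation in heq; auto.
  fold a in heq; rewrite <- heq; simpl Derive_n.
  change (is_derive (Derive psi) t (Derive (Derive psi) t)); apply Derive_correct, hd. }
destruct (half_line_solution psi (Derive psi) k a L0 hk) with (x := x) as [r1 r2]; auto.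
{ intros t ht; rewrite <- (Rabs_pos_eq t) at 2 by lra; apply d1; lra. }
destruct (half_line_solution (fun t => psi (- t)) (fun t => - Derive psi (- t)) k a L0 hk) with (x := x) as [q1 q2]; auto.
{ intros t ht; auto_derive; [eexists; eauto | change (Derive (fun x : R => psi x)) with (Derive psi); ring]. }
{ intros t ht; specialize (d1 (- t) ltac:(lra)).
  rewrite Rabs_Ropp, (Rabs_pos_eq t) in d1 by lra.
  auto_derive; [eexists; eauto |].
  rewrite (is_derive_unique (fun x : R => Derive psi x) _ _ d1); ring. }
rewrite Ropp_0 in q1, q2.
split; [auto | split; [rewrite q1; field; lra | split; auto]].
apply Ropp_eq_compat in q2; rewrite Ropp_involutive in q2; rewrite q2; ring.
Qed.

(** Through [eigen_formula] the two boundary conditions decouple: one only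
    involves [psi 0], the other one only [Derive psi 0].  The right end has a
    Neumann condition when parity and boundary sign agree (even and periodic,
    or odd and antiperiodic), hence the [xorb]. *)
Lemma eigen_even psi : W psi -> psi 0 = 0 \/ right_cond u u1 v v1 false (xorb false sb) cc a.
Proof.
intros h; destruct (Req_dec (psi 0) 0) as [e | n]; [left; auto | right].
destruct (eigen_formula psi L0 h) as (f1 & f2 & f3 & f4); [lra |].
destruct h as (_ & _ & b0 & b1); rewrite scaled_right_end in *.
assert (hk := k_pos).
unfold right_cond; change (left_sol u u1 v v1 false a) with (neumann_sol a);
change (left_sol1 u u1 v v1 false a) with (neumann_sol1 a).
destruct sb; simpl in *.
- rewrite f3, f4 in b1.
  assert (hz : (k * psi 0) * neumann_sol1 a (cc - a) = 0) by lra.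
  apply Rmult_integral in hz; destruct hz as [hz | hz]; auto.
  apply Rmult_integral in hz; lra.
- rewrite f1, f2 in b0.
  assert (hz : psi 0 * neumann_sol a (cc - a) = 0) by lra.
  apply Rmult_integral in hz; destruct hz as [hz | hz]; auto; lra.
Qed.

Lemma eigen_odd psi : W psi -> Derive psi 0 = 0 \/ right_cond u u1 v v1 true (xorb true sb) cc a.
Proof.
intros h; destruct (Req_dec (Derive psi 0) 0) as [e | n]; [left; auto | right].
destruct (eigen_formula psi L0 h) as (f1 & f2 & f3 & f4); [lra |].
destruct h as (_ & _ & b0 & b1); rewrite scaled_right_end in *.
assert (hk := k_pos).
unfold right_cond.
replace (left_sol u u1 v v1 true a (cc - a)) with (- dirichlet_sol a (cc - a)) by (unfold dirichlet_sol; ring).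
replace (left_sol1 u u1 v v1 true a (cc - a)) with (- dirichlet_sol1 a (cc - a)) by (unfold dirichlet_sol1; ring).
destruct sb; simpl in *.
- rewrite f1, f2 in b0.
  assert (hz : Derive psi 0 / k * dirichlet_sol a (cc - a) = 0) by lra.
  apply Rmult_integral in hz; destruct hz as [hz | ->]; [ | ring].
  exfalso; apply n; replace (Derive psi 0) with (Derive psi 0 / k * k) by (field; lra); rewrite hz; ring.
- rewrite f3, f4 in b1.
  assert (hz : Derive psi 0 * dirichlet_sol1 a (cc - a) = 0) by lra.
  apply Rmult_integral in hz; destruct hz as [hz | ->]; [lra | ring].
Qed.

Lemma eigen_from_data psi phi s t : W psi -> W phi ->
  s * psi 0 + t * phi 0 = 0 -> s * Derive psi 0 + t * Derive phi 0 = 0 ->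
  forall x, - L0 <= x <= L0 -> s * psi x + t * phi x = 0.
Proof.
intros h1 h2 e0 e1 x hx.
assert (hk := k_pos).
assert (key : forall y, 0 <= y <= L0 -> s * psi y + t * phi y = 0 /\ s * psi (- y) + t * phi (- y) = 0).
{ intros y hy; destruct (eigen_formula psi y h1 hy) as (-> & -> & _ & _).
  destruct (eigen_formula phi y h2 hy) as (-> & -> & _ & _).
  set (n := neumann_sol a (k * y - a)); set (d := dirichlet_sol a (k * y - a)).
  assert (e : s * (Derive psi 0 / k) + t * (Derive phi 0 / k) = 0).
  { replace (s * (Derive psi 0 / k) + t * (Derive phi 0 / k)) with ((s * Derive psi 0 + t * Derive phi 0) / k) by (field; lra).
    rewrite e1; unfold Rdiv; ring. }
  split.
  - transitivity ((s * psi 0 + t * phi 0) * n + (s * (Derive psi 0 / k) + t * (Derive phi 0 / k)) * d); [ring | rewrite e0, e; ring].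
  - transitivity ((s * psi 0 + t * phi 0) * n - (s * (Derive psi 0 / k) + t * (Derive phi 0 / k)) * d); [ring | rewrite e0, e; ring]. }
destruct (Rle_lt_dec 0 x) as [h | h].
- apply key; lra.
- destruct (key (- x)) as [_ q]; [lra |]; rewrite Ropp_involutive in q; auto.
Qed.

(** The solution on the right half, reflected with the sign of its parity,
    is twice differentiable at [0] because its slope or its value vanishes
    there. *)
Lemma eigen_exists o : right_cond u u1 v v1 o (xorb o sb) cc a ->
  exists psi, W psi /\ (psi 0 <> 0 \/ Derive psi 0 <> 0).
Proof.
intros hr; assert (hk := k_pos).
set (y := left_sol u u1 v v1 o a); set (y1 := left_sol1 u u1 v v1 o a).
assert (ay : airy y y1) by (apply left_sol_airy; auto).
assert (d0 := airy_derive _ _ ay); assert (d1 := airy_derive_slope _ _ ay).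
set (sg := if o then -1 else 1).
assert (hsg : (o = false /\ sg = 1 /\ y (- a) = 1 /\ y1 (- a) = 0) \/
  (o = true /\ sg = -1 /\ y (- a) = 0 /\ y1 (- a) = -1)).
{ destruct (sols_left a) as (l1 & l2 & l3 & l4).
  unfold y, y1, sg; destruct o; [right | left]; repeat split; auto;
    unfold dirichlet_sol, dirichlet_sol1 in l3, l4; lra. }
set (h := fun x => if Rlt_dec x 0 then sg * y (- k * x - a) else y (k * x - a)).
set (h1 := fun x => if Rlt_dec x 0 then - sg * k * y1 (- k * x - a) else k * y1 (k * x - a)).
set (h2 := fun x => if Rlt_dec x 0 then sg * k ^ 2 * (- k * x - a) * y (- k * x - a)
   else k ^ 2 * (k * x - a) * y (k * x - a)).
assert (z1 : - k * 0 - a = - a) by ring.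
assert (z2 : k * 0 - a = - a) by ring.
assert (dh : forall x, is_derive h x (h1 x)).
{ apply (glue_derive (fun x => sg * y (- k * x - a)) (fun x => y (k * x - a))
    (fun x => - sg * k * y1 (- k * x - a)) (fun x => k * y1 (k * x - a))).
  - intros x; auto_derive; [repeat split; eexists; eauto | use_derive d0; unfold Rminus; ring].
  - intros x; auto_derive; [repeat split; eexists; eauto | use_derive d0; unfold Rminus; ring].
  - rewrite z1, z2; destruct hsg as [(_ & -> & -> & _) | (_ & -> & -> & _)]; ring.
  - rewrite z1, z2; destruct hsg as [(_ & -> & _ & ->) | (_ & -> & _ & ->)]; ring. }
assert (dh1 : forall x, is_derive h1 x (h2 x)).
{ apply (glue_derive (fun x => - sg * k * y1 (- k * x - a)) (fun x => k * y1 (k * x - a))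
    (fun x => sg * k ^ 2 * (- k * x - a) * y (- k * x - a)) (fun x => k ^ 2 * (k * x - a) * y (k * x - a))).
  - intros x; auto_derive; [repeat split; eexists; eauto | use_derive d1; unfold Rminus; ring].
  - intros x; auto_derive; [repeat split; eexists; eauto | use_derive d1; unfold Rminus; ring].
  - rewrite z1, z2; destruct hsg as [(_ & -> & _ & ->) | (_ & -> & _ & ->)]; ring.
  - rewrite z1, z2; destruct hsg as [(_ & -> & -> & _) | (_ & -> & -> & _)]; ring. }
assert (eD : forall x, Derive h x = h1 x) by (intros; apply is_derive_unique; auto).
assert (dD : forall x, is_derive (Derive h) x (h2 x)).
{ intros x; apply (is_derive_ext h1); auto. }
exists h; split; [split; [ | split; [ | split]] |].
- intros x; split; eexists; eauto.
- intros x hx; apply scaled_equation; auto.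
  simpl; transitivity (h2 x); [apply is_derive_unique, dD |].
  unfold h2, h; fold a; destruct (Rlt_dec x 0).
  + rewrite Rabs_left by auto; replace (k * - x) with (- k * x) by ring; ring.
  + rewrite Rabs_pos_eq by lra; ring.
- unfold h; destruct (Rlt_dec L0 0); [lra |]; destruct (Rlt_dec (- L0) 0); [ | lra].
  replace (- k * - L0 - a) with (k * L0 - a) by ring; rewrite scaled_right_end.
  unfold right_cond in hr; fold y y1 in hr.
  destruct hsg as [(-> & -> & _) | (-> & -> & _)]; destruct sb; simpl in *; rewrite ?hr; ring.
- rewrite !eD; unfold h1; destruct (Rlt_dec L0 0); [lra |]; destruct (Rlt_dec (- L0) 0); [ | lra].
  replace (- k * - L0 - a) with (k * L0 - a) by ring; rewrite scaled_right_end.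
  unfold right_cond in hr; fold y y1 in hr.
  destruct hsg as [(-> & -> & _) | (-> & -> & _)]; destruct sb; simpl in *; rewrite ?hr; ring.
- rewrite eD; unfold h, h1; destruct (Rlt_dec 0 0); [lra |]; rewrite z2.
  destruct hsg as [(_ & _ & -> & _) | (_ & _ & _ & ->)]; [left | right]; lra.
Qed.

Lemma eigen_zero_data psi : (forall x, - L0 <= x <= L0 -> psi x = 0) ->
  psi 0 = 0 /\ Derive psi 0 = 0.
Proof.
intros h; split; [apply h; lra |].
rewrite (Derive_ext_loc psi (fun _ => 0)); [apply Derive_const |].
exists (mkposreal _ hL0); intros t ht; apply h.
unfold ball in ht; simpl in ht; unfold AbsRing_ball, abs, minus, plus, opp in ht; simpl in ht.
apply Rabs_def2 in ht; lra.
Qed.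

Lemma lincomb_zeros (f : list (R -> R)) x : lincomb (repeat 0 (length f)) f x = 0.
Proof.
induction f as [ | g f IH]; auto.
unfold lincomb in *; simpl; rewrite IH; ring.
Qed.

Variable e : nat -> R.
Hypothesis he : eigenvalue_sequence hbar m L0 V (sign_of sb) e.

Lemma eigenvalue_cond n : e n = E -> exists o, right_cond u u1 v v1 o (xorb o sb) cc a.
Proof.
intros hn; destruct he as [_ he2]; destruct (he2 E) as [f [l [[hb1 [hb2 hb3]] [_ [hl hlen]]]]].
assert (hin : In n l) by (apply hl; auto).
destruct f as [ | g f]; [destruct l; [destruct hin | discriminate hlen] |].
assert (hg : W g) by (apply hb1; left; auto).
destruct (eigen_even g hg) as [e0 | ]; [ | exists false; auto].
destruct (eigen_odd g hg) as [e1 | ]; [ | exists true; auto].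
exfalso; apply R1_neq_R0.
apply (hb2 (1 :: repeat 0 (length f))).
- simpl; now rewrite repeat_length.
- intros x hx.
  assert (z := eigen_from_data g g 1 0 hg hg ltac:(rewrite e0; ring) ltac:(rewrite e1; ring) x hx).
  assert (lz := lincomb_zeros f x); unfold lincomb in *; simpl; rewrite lz; lra.
- left; auto.
Qed.

Lemma cond_eigenvalue o : right_cond u u1 v v1 o (xorb o sb) cc a -> exists n, e n = E.
Proof.
intros ho; destruct (eigen_exists o ho) as [psi [hpsi hnz]].
destruct he as [_ he2]; destruct (he2 E) as [f [l [[hb1 [hb2 hb3]] [_ [hl hlen]]]]].
destruct l as [ | n l]; [ | exists n; apply hl; left; auto].
destruct f as [ | g f]; [ | discriminate hlen].
exfalso; destruct (hb3 psi hpsi) as [b [hb hz]].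
destruct (eigen_zero_data psi); [ | tauto].
intros x hx; rewrite hz by auto; destruct b; [auto | discriminate hb].
Qed.

(** If only one parity is possible, all eigenfunctions share a vanishing datum
    at [0], so any two of them are proportional. *)
Lemma eigenvalue_simple n n' :
  ~ (right_cond u u1 v v1 false (xorb false sb) cc a /\ right_cond u u1 v v1 true (xorb true sb) cc a) ->
  e n = E -> e n' = E -> n = n'.
Proof.
intros hnot hn hn'; destruct (Nat.eq_dec n n') as [ | hne]; auto; exfalso.
destruct he as [_ he2]; destruct (he2 E) as [f [l [[hb1 [hb2 hb3]] [hnd [hl hlen]]]]].
assert (h2 : (2 <= length l)%nat).
{ apply (NoDup_incl_length (l := n :: n' :: nil)).
  - apply NoDup_cons; [simpl; intros [q | []]; auto | apply NoDup_cons; [simpl; tauto | apply NoDup_nil]].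
  - intros i [<- | [<- | []]]; apply hl; auto. }
rewrite hlen in h2.
destruct f as [ | g [ | g' f]]; simpl in h2; try lia.
assert (hg : W g) by (apply hb1; left; auto).
assert (hg' : W g') by (apply hb1; right; left; auto).
assert (indep : forall s t, s * g 0 + t * g' 0 = 0 -> s * Derive g 0 + t * Derive g' 0 = 0 -> s = 0 /\ t = 0).
{ intros s t e0 e1.
  assert (hz : forall r, In r (s :: t :: repeat 0 (length f)) -> r = 0).
  { apply hb2; [simpl; now rewrite repeat_length |].
    intros x hx; assert (z := eigen_from_data g g' s t hg hg' e0 e1 x hx).
    assert (lz := lincomb_zeros f x); unfold lincomb in *; simpl; rewrite lz; lra. }
  split; apply hz; simpl; auto. }
destruct (eigen_even g hg) as [e0 | ce].
- destruct (eigen_even g' hg') as [e0' | ce].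
  + destruct (indep (Derive g' 0) (- Derive g 0)) as [z1 z2]; [rewrite e0, e0'; ring | ring |].
    destruct (indep 1 0) as [z3 _]; [rewrite e0; ring | | lra].
    replace (Derive g 0) with 0 by lra; ring.
  + destruct (eigen_odd g hg) as [e1 | co]; [ | tauto].
    destruct (indep 1 0) as [z3 _]; [rewrite e0; ring | rewrite e1; ring | lra].
- destruct (eigen_odd g hg) as [e1 | co]; [ | tauto].
  destruct (eigen_odd g' hg') as [e1' | co]; [ | tauto].
  destruct (indep (g' 0) (- g 0)) as [z1 z2]; [ring | rewrite e1, e1'; ring |].
  destruct (indep 1 0) as [z3 _]; [ | rewrite e1; ring | lra].
  replace (g 0) with 0 by lra; ring.
Qed.
End Energy.
End Reduction.

(** * Counting the band edges *)
Section Counting.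
Variables (u u1 v v1 : R -> R) (c ct : nat -> R).
Hypothesis hf : fundamental u u1 v v1.
Hypothesis hz : zeros_located u u1 v v1 c ct.
Variables (cc : R) (k0 : nat).
Hypothesis (hcc : c k0 < cc < c (S k0)).

Lemma c_increasing : forall i j, (i < j)%nat -> c i < c j.
Proof. apply increasing_lt; intros j; destruct (zl_lt _ _ _ _ _ _ hz j); lra. Qed.

Lemma c_le i j : (i <= j)%nat -> c i <= c j.
Proof.
intros h; destruct (Nat.eq_dec i j) as [-> | n]; [lra | left; apply c_increasing; lia].
Qed.

Lemma prev_end_nonneg p : 0 <= prev_end ct p.
Proof. destruct p; simpl; [lra | destruct (zl_early _ _ _ _ _ _ hz p); lra]. Qed.

Lemma prev_end_lt p : prev_end ct p < c p.
Proof.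
destruct p as [ | p]; simpl; [destruct (zl_early _ _ _ _ _ _ hz 0); lra | apply (zl_lt _ _ _ _ _ _ hz p)].
Qed.

Lemma c_le_prev_end i j : (i < j)%nat -> c i < prev_end ct j.
Proof.
intros h; destruct j as [ | j]; [lia | simpl].
apply Rle_lt_trans with (c j); [apply c_le; lia | apply (zl_lt _ _ _ _ _ _ hz j)].
Qed.

(** For [a <= 0] the whole cell lies in [xi >= 0], where solutions that start
    with value or slope zero grow. *)
Lemma no_cond_below o nm a : a <= 0 -> right_cond u u1 v v1 o nm cc a -> False.
Proof.
intros ha hr.
destruct (zl_early _ _ _ _ _ _ hz k0) as [hpos _].
assert (hlt : - a < cc - a) by lra.
destruct (sols_left _ _ _ _ hf a) as (l1 & l2 & l3 & l4).
unfold right_cond in hr; destruct o.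
- destruct (airy_growth _ _ (- a) (cc - a) (airy_combination v v1 u u1 (u (- a)) (v (- a)) (fund_v _ _ _ _ hf) (fund_u _ _ _ _ hf))) as [g1 g2]; auto; try lra;
  unfold dirichlet_sol, dirichlet_sol1, left_sol, left_sol1, left_data in *; try lra.
  destruct nm; lra.
- destruct (airy_growth _ _ (- a) (cc - a) (left_sol_airy u u1 v v1 false a hf)) as [g1 g2];
  unfold neumann_sol, neumann_sol1 in *; auto; try lra.
  destruct nm; lra.
Qed.

(** To the right of [0] all of [u], [v] and their derivatives are positive, so
    the condition equates [p / q] with a positive number. *)
Lemma cond_sign o nm a : 0 < a < cc -> right_cond u u1 v v1 o nm cc a ->
  0 < left_data v v1 o a * left_data u u1 o a.
Proof.
intros ha hr.
destruct (fund_pos _ _ _ _ (cc - a) hf) as (p1 & p2 & p3 & p4); [lra |].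
assert (nb := left_data_not_both _ _ _ _ o a hf).
set (p := left_data v v1 o a) in *; set (q := left_data u u1 o a) in *.
assert (key : forall x y, 0 < x -> 0 < y -> p * x - q * y = 0 -> 0 < p * q).
{ intros x y hx hy e.
  assert (hq : q <> 0).
  { intros q0; apply nb; auto; rewrite q0 in e.
    assert (p * x = 0) by lra. apply Rmult_integral in H; lra. }
  assert (0 < (p * q) * x); [ | nra].
  replace (p * q * x) with (q * (p * x)) by ring.
  replace (p * x) with (q * y) by lra.
  assert (0 < q ^ 2) by nra. nra. }
unfold right_cond, left_sol, left_sol1 in hr; fold p q in hr; destruct nm; eapply key; try exact hr; auto.
Qed.

Lemma zone_cover a N : 0 < a < c N ->
  (exists q, prev_end ct q < a < c q) \/ (exists q, c q <= a <= ct q).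
Proof.
induction N as [ | N IH]; intros ha.
- left; exists 0%nat; simpl; lra.
- destruct (Rlt_le_dec a (c N)) as [h | h]; [apply IH; lra |].
  destruct (Rle_lt_dec a (ct N)) as [h' | h']; [right; exists N; lra | left; exists (S N); simpl; lra].
Qed.

Lemma cond_in_band o nm a : a < cc -> right_cond u u1 v v1 o nm cc a ->
  exists q, prev_end ct q < a < c q /\ Nat.odd q = o.
Proof.
intros ha hr.
destruct (Rle_lt_dec a 0) as [h0 | h0]; [destruct (no_cond_below o nm a); auto |].
assert (s := cond_sign o nm a ltac:(lra) hr).
destruct (zone_cover a (S k0)) as [[q hq] | [q hq]]; [lra | | ].
- exists q; split; auto.
  destruct (zl_band _ _ _ _ _ _ hz q a hq) as [_ s'].
  destruct o, (Nat.odd q); auto; cbn [negb] in s'; lra.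
- assert (s' := zl_gap _ _ _ _ _ _ hz q o a hq); lra.
Qed.

Lemma even_odd_exclusive sb a : a <= cc ->
  ~ (right_cond u u1 v v1 false (xorb false sb) cc a /\ right_cond u u1 v v1 true (xorb true sb) cc a).
Proof.
intros ha [h1 h2].
destruct (Rlt_le_dec a cc) as [h | h].
- destruct (cond_in_band _ _ _ h h1) as [q [hq oq]].
  destruct (Rle_lt_dec a 0) as [h0 | h0]; [eapply no_cond_below; eauto |].
  assert (s := cond_sign true _ a ltac:(lra) h2).
  destruct (zl_band _ _ _ _ _ _ hz q a hq) as [_ s'].
  rewrite oq in s'; cbn [negb] in s'; lra.
- assert (a = cc) as -> by lra.
  (* At [a = cc] the right end is [xi = 0], where [u] and [v] take their
     initial values: one of the two conditions makes [cc] one of the [c p]. *)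
  assert (hv : v (- cc) = 0 \/ v1 (- cc) = 0).
  { unfold right_cond, left_sol, left_sol1, left_data in h1, h2.
    replace (cc - cc) with 0 in * by ring.
    rewrite (fund_u0 _ _ _ _ hf), (fund_v0 _ _ _ _ hf), (fund_u10 _ _ _ _ hf), (fund_v10 _ _ _ _ hf) in *.
    destruct sb; simpl in *; lra. }
  destruct (zl_early _ _ _ _ _ _ hz k0) as [hpos _].
  destruct (zl_complete _ _ _ _ _ _ hz cc ltac:(lra) hv) as [p hp].
  destruct (Nat.le_gt_cases p k0) as [hle | hlt].
  + assert (h3 := c_le p k0 hle); lra.
  + assert (h3 := c_le (S k0) p hlt); lra.
Qed.

Lemma band_points_below p : (p <= k0)%nat -> exists alpha beta,
  prev_end ct p < alpha /\ alpha < beta /\ beta < c p /\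
  (forall a, prev_end ct p < a < c p -> (right_cond u u1 v v1 (Nat.odd p) true cc a <-> a = alpha)) /\
  (forall a, prev_end ct p < a < c p -> (right_cond u u1 v v1 (Nat.odd p) false cc a <-> a = beta)).
Proof.
intros hp; apply band_points; auto.
- apply prev_end_nonneg.
- apply prev_end_lt.
- assert (h := c_le p k0 hp); lra.
- intros a ha; apply (zl_band _ _ _ _ _ _ hz p a ha).
- apply (zl_left _ _ _ _ _ _ hz).
- apply (zl_right _ _ _ _ _ _ hz).
Qed.

Lemma band_point_unique p nm : (p <= k0)%nat ->
  (exists a, prev_end ct p < a < c p /\ right_cond u u1 v v1 (Nat.odd p) nm cc a) /\
  (forall a b, prev_end ct p < a < c p -> prev_end ct p < b < c p ->
   right_cond u u1 v v1 (Nat.odd p) nm cc a -> right_cond u u1 v v1 (Nat.odd p) nm cc b -> a = b).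
Proof.
intros hp; destruct (band_points_below p hp) as (al & be & h1 & h2 & h3 & h4 & h5); destruct nm; split.
- exists al; split; [lra | apply h4; lra].
- intros a b ha hb ra rb; apply h4 in ra; apply h4 in rb; auto; congruence.
- exists be; split; [lra | apply h5; lra].
- intros a b ha hb ra rb; apply h5 in ra; apply h5 in rb; auto; congruence.
Qed.
End Counting.

Section Edges.
Variables (u u1 v v1 : R -> R) (c ct : nat -> R).
Hypothesis hf : fundamental u u1 v v1.
Hypothesis hz : zeros_located u u1 v v1 c ct.
Variables hbar m L0 V0 : R.
Hypothesis (hhbar : 0 < hbar) (hm : 0 < m) (hL0 : 0 < L0) (hV0 : 0 < V0).
Variable V : R -> R.
Hypothesis hV : periodic_potential L0 V0 V.
Let th := theta hbar m L0 V0.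
Let cc := th * V0.
Variable k0 : nat.
Hypothesis (hcc : c k0 < cc < c (S k0)).

(** Induction on [n]: the interval of index [n] contains a point that is an
    eigenvalue, so the [n]-th eigenvalue is at most that.  It then lies in one
    of the intervals up to [n] of its parity; an earlier one is already taken
    by a simple eigenvalue. *)
Lemma nth_eigenvalue sb e : eigenvalue_sequence hbar m L0 V (sign_of sb) e ->
  forall n, (n <= k0)%nat ->
  prev_end ct n < cc + th * e n < c n /\
  right_cond u u1 v v1 (Nat.odd n) (xorb (Nat.odd n) sb) cc (cc + th * e n).
Proof.
intros he n; induction n as [n IH] using (well_founded_induction Wf_nat.lt_wf); intros hn.
assert (ht : 0 < th) by apply exp_pos.
assert (mono : forall i j, (i <= j)%nat -> e i <= e j).
{ intros i j hij; induction hij as [ | j hij IHj]; [lra |].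
  apply Rle_trans with (e j); auto; apply he. }
destruct (band_point_unique _ _ _ _ _ _ hf hz cc k0 hcc n (xorb (Nat.odd n) sb) hn) as [[g [hg rg]] _].
assert (eg : cc + th * ((g - cc) / th) = g) by (field; lra).
destruct (cond_eigenvalue _ _ _ _ hf hbar m L0 V0 hhbar hm hL0 hV0 V hV sb ((g - cc) / th) e he (Nat.odd n)) as [k hk].
{ fold th; fold cc; rewrite eg; auto. }
assert (ek : cc + th * e k = g) by (rewrite hk; auto).
(* The points of smaller index lie in intervals to the left. *)
assert (hkn : (n <= k)%nat).
{ destruct (Nat.le_gt_cases n k) as [ | hlt]; auto; exfalso.
  destruct (IH k hlt) as [hb _]; [lia |].
  assert (h := c_le_prev_end _ _ _ _ _ _ hz k n hlt); lra. }
assert (han : cc + th * e n <= g).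
{ rewrite <- ek; apply Rplus_le_compat_l, Rmult_le_compat_l; [lra | auto]. }
assert (hcn : c n <= c k0) by (eapply c_le; eauto).
destruct (eigenvalue_cond _ _ _ _ hf hbar m L0 V0 hhbar hm hL0 hV0 V hV sb (e n) e he n eq_refl) as [o ho].
fold th in ho; fold cc in ho.
destruct (cond_in_band _ _ _ _ _ _ hf hz cc k0 hcc o _ (cc + th * e n) ltac:(lra) ho) as [q [hq oq]].
destruct (Nat.lt_total q n) as [hlt | [-> | hlt]].
- exfalso; destruct (IH q hlt) as [hbq rq]; [lia |].
  rewrite <- oq in ho.
  destruct (band_point_unique _ _ _ _ _ _ hf hz cc k0 hcc q (xorb (Nat.odd q) sb)) as [_ uq]; [lia |].
  specialize (uq _ _ hq hbq ho rq).
  assert (en : e n = e q) by (apply (Rmult_eq_reg_l th); lra).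
  assert (n = q); [ | lia].
  apply (eigenvalue_simple _ _ _ _ hf hbar m L0 V0 hhbar hm hL0 hV0 V hV sb (e n) e he); auto.
  fold th; fold cc; apply (even_odd_exclusive _ _ _ _ c ct hf hz cc k0 hcc); lra.
- rewrite <- oq in ho; auto.
- exfalso; assert (h := c_le_prev_end _ _ _ _ _ _ hz n q hlt); lra.
Qed.

Variables Emin Emax : nat -> R.
Hypothesis hE : band_edges hbar m L0 V Emin Emax.

Lemma band_edges_located p : (p <= k0)%nat ->
  prev_end ct p < cc + th * Emin p /\ th * Emin p < th * Emax p /\ cc + th * Emax p < c p.
Proof.
intros hp; destruct hE as [hper hanti].
assert (H : forall n E, (exists sb, xorb (Nat.odd p) sb = n /\
   exists e, eigenvalue_sequence hbar m L0 V (sign_of sb) e /\ e p = E) ->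
   prev_end ct p < cc + th * E < c p /\ right_cond u u1 v v1 (Nat.odd p) n cc (cc + th * E)).
{ intros n E [sb [<- [e [he <-]]]]; apply nth_eigenvalue; auto. }
destruct (H true (Emin p)) as [i1 r1].
{ exists (Nat.even p); split; [rewrite <- Nat.negb_odd; destruct (Nat.odd p); auto |].
  destruct (Nat.even p) eqn:ev.
  - exists (fun p => if Nat.even p then Emin p else Emax p); rewrite ev; auto.
  - exists (fun p => if Nat.even p then Emax p else Emin p); rewrite ev; auto. }
destruct (H false (Emax p)) as [i2 r2].
{ exists (Nat.odd p); split; [destruct (Nat.odd p); auto |].
  rewrite <- Nat.negb_even; destruct (Nat.even p) eqn:ev; simpl.
  - exists (fun p => if Nat.even p then Emax p else Emin p); rewrite ev; auto.
  - exists (fun p => if Nat.even p then Emin p else Emax p); rewrite ev; auto. }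
destruct (band_points_below _ _ _ _ _ _ hf hz cc k0 hcc p hp) as (al & be & h1 & h2 & h3 & h4 & h5).
apply h4 in r1; auto; apply h5 in r2; auto; lra.
Qed.

(** The two edges of a gap are consecutive terms of one eigenvalue sequence.
    Equality would make a double eigenvalue, hence an even and an odd
    eigenfunction at once. *)
Lemma gap_open p : Emin (S p) <= 0 -> Emax p < Emin (S p).
Proof.
intros h0; destruct hE as [hper hanti].
assert (H : exists sb e, eigenvalue_sequence hbar m L0 V (sign_of sb) e /\ e p = Emax p /\ e (S p) = Emin (S p)).
{ destruct (Nat.even p) eqn:ev.
  - exists false, (fun p => if Nat.even p then Emax p else Emin p).
    rewrite Nat.even_succ, <- Nat.negb_even, ev; auto.
  - exists true, (fun p => if Nat.even p then Emin p else Emax p).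
    rewrite Nat.even_succ, <- Nat.negb_even, ev; auto. }
destruct H as (sb & e & he & e1 & e2).
rewrite <- e1; rewrite <- e2 in *.
destruct (proj1 he p) as [h | h]; auto; exfalso.
assert (p = S p); [ | lia].
apply (eigenvalue_simple _ _ _ _ hf hbar m L0 V0 hhbar hm hL0 hV0 V hV sb (e (S p)) e he); auto.
fold th; fold cc; apply (even_odd_exclusive _ _ _ _ c ct hf hz cc k0 hcc).
assert (ht : 0 < th) by apply exp_pos; nra.
Qed.
End Edges.

(** * Numerical bounds *)
(** Mean value bounds for [zeta], whose derivative is [sqrt]. *)
Lemma zeta_diff x y : 0 < x -> x <= y ->
  (zeta y - zeta x) / sqrt y <= y - x <= (zeta y - zeta x) / sqrt x.
Proof.
intros hx hxy.
assert (sx : 0 < sqrt x) by (apply sqrt_lt_R0; auto).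
assert (sxy : sqrt x <= sqrt y) by (apply sqrt_le_1; lra).
assert (ex : sqrt x ^ 2 = x) by (apply pow2_sqrt; lra).
assert (ey : sqrt y ^ 2 = y) by (apply pow2_sqrt; lra).
assert (e : y - x = sqrt y ^ 2 - sqrt x ^ 2) by lra.
rewrite e; unfold zeta; clear e ex ey.
set (a := sqrt x) in *; set (b := sqrt y) in *.
split; [apply div_le | apply le_div]; try lra.
- assert (0 <= (b - a) * (b - a) * (2 * a + b)) by (apply Rmult_le_pos; [apply Rle_0_sqr | lra]).
  lra.
- assert (0 <= (b - a) * (b - a) * (a + 2 * b)) by (apply Rmult_le_pos; [apply Rle_0_sqr | lra]).
  lra.
Qed.

Lemma cube_le x y : 0 <= y -> x ^ 3 <= y ^ 3 -> x <= y.
Proof.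
intros hy h; destruct (Rle_lt_dec x y) as [l | l]; auto; exfalso.
assert (0 < (x - y) * (x ^ 2 + x * y + y ^ 2)) by (apply Rmult_lt_0_compat; nra).
nra.
Qed.

(** [PI / scale_root n] is [PI (3 / PI)^(1/3) / n^(1/3)], the scale of all the
    bounds; asymptotically [sqrt (c p)] is [(9/4)^(1/3)] times
    [scale_root p]. *)
Definition scale_root (n : R) : R := Rpower (PI * n / 3) (1 / 3).

Lemma scale_root_spec n : 0 < n -> 0 < scale_root n /\ scale_root n ^ 3 = PI * n / 3.
Proof.
intros hn; split; [apply exp_pos |].
apply Rpower_third_cube; pose proof PI_RGT_0.
apply Rdiv_lt_0_compat; [apply Rmult_lt_0_compat; lra | lra].
Qed.

Lemma scale_root_inv n : 0 < n ->
  Rpower (3 / PI) (1 / 3) * (1 / Rpower n (1 / 3)) = 1 / scale_root n.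
Proof.
intros hn; pose proof PI_RGT_0.
assert (0 < Rpower n (1 / 3)) by apply exp_pos.
destruct (scale_root_spec n hn) as [h _].
apply (Rmult_eq_reg_r (Rpower n (1 / 3) * scale_root n)); [ | nra].
transitivity (Rpower (3 / PI) (1 / 3) * scale_root n); [field; lra |].
transitivity (Rpower n (1 / 3)); [ | field; lra].
unfold scale_root; rewrite Rpower_mult_distr.
- f_equal; field; lra.
- apply Rdiv_lt_0_compat; lra.
- apply Rdiv_lt_0_compat; [apply Rmult_lt_0_compat; lra | lra].
Qed.

Lemma gap_lower_constant n : 0 < n ->
  0 < I_fun (Rpower (7 / 6) (2 / 3)) * (Rpower 2 (1 / 3) * Rpower PI (2 / 3) / 9) * (1 / Rpower n (1 / 3))
  <= 0.24 / scale_root n.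
Proof.
intros hn; pose proof PI_bounds.
destruct (scale_root_spec n hn) as [hs _].
assert (hN : 0 < Rpower n (1 / 3)) by apply exp_pos.
set (T := Rpower (7 / 6) (2 / 3)).
assert (hT : 0 < T) by apply exp_pos.
assert (T32 : Rpower T (3 / 2) = 7 / 6).
{ unfold T; rewrite Rpower_mult; replace (2 / 3 * (3 / 2)) with 1 by field; apply Rpower_1; lra. }
assert (T3 : T ^ 3 = 49 / 36).
{ rewrite <- Rpower_pow by auto; unfold T; rewrite Rpower_mult.
  replace (2 / 3 * INR 3) with (INR 2) by (simpl; field).
  rewrite Rpower_pow by lra; simpl; field. }
assert (T1 : 1.1 <= T) by (apply cube_le; lra).
assert (e : I_fun T * (Rpower 2 (1 / 3) * Rpower PI (2 / 3) / 9) * (1 / Rpower n (1 / 3)) =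
  13 / 6 / (T ^ 2 + T + 1) * (PI / 9) / scale_root n).
{ unfold I_fun; rewrite T32.
  assert (e1 : Rpower (3 / 2) (1 / 3) * Rpower 2 (1 / 3) = Rpower 3 (1 / 3)).
  { rewrite Rpower_mult_distr by lra; f_equal; field. }
  assert (e2 : scale_root n * Rpower 3 (1 / 3) = Rpower PI (1 / 3) * Rpower n (1 / 3)).
  { unfold scale_root; rewrite !Rpower_mult_distr; try lra; [f_equal; field |].
    apply Rdiv_lt_0_compat; [apply Rmult_lt_0_compat; lra | lra]. }
  assert (e3 : Rpower PI (1 / 3) * Rpower PI (2 / 3) = PI).
  { rewrite <- Rpower_plus; replace (1 / 3 + 2 / 3) with 1 by field; apply Rpower_1; lra. }
  assert (0 < T ^ 2 + T + 1) by nra.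
  apply (Rmult_eq_reg_r (scale_root n)); [ | lra].
  transitivity (13 / 6 / (T ^ 2 + T + 1) / 9 * ((Rpower (3 / 2) (1 / 3) * Rpower 2 (1 / 3)) * Rpower PI (2 / 3) / Rpower n (1 / 3)) * scale_root n).
  { field; split; lra. }
  rewrite e1.
  transitivity (13 / 6 / (T ^ 2 + T + 1) / 9 * ((scale_root n * Rpower 3 (1 / 3)) * Rpower PI (2 / 3) / Rpower n (1 / 3))).
  { field; split; lra. }
  rewrite e2.
  transitivity (13 / 6 / (T ^ 2 + T + 1) / 9 * (Rpower PI (1 / 3) * Rpower PI (2 / 3))).
  { field; split; lra. }
  rewrite e3; field; split; lra. }
rewrite e.
assert (hden : 3.31 <= T ^ 2 + T + 1) by nra.
split.
- apply Rdiv_lt_0_compat; auto; apply Rmult_lt_0_compat; [apply Rdiv_lt_0_compat |]; lra.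
- apply Rmult_le_compat_r; [left; apply Rinv_0_lt_compat; auto |].
  assert (h1 : 13 / 6 / (T ^ 2 + T + 1) <= 0.656) by (apply div_le; lra).
  assert (h0 : 0 < 13 / 6 / (T ^ 2 + T + 1)) by (apply Rdiv_lt_0_compat; lra).
  nra.
Qed.

Section Estimates.
Variables (u u1 v v1 : R -> R) (c ct : nat -> R).
Hypothesis hz : zeros_located u u1 v v1 c ct.

Let INR_ge p n : (n <= p)%nat -> INR n <= INR p := le_INR n p.

(** [1.3] is just below [(9/4)^(1/3)]. *)
Lemma sqrt_ct_lower p : (1 <= p)%nat -> 1.3 * scale_root (INR p) <= sqrt (ct (p - 1)%nat).
Proof.
intros hp; pose proof PI_bounds.
assert (h1 := INR_ge _ _ hp); simpl INR in h1.
destruct (scale_root_spec (INR p)) as [s s3]; [lra |].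
destruct (zl_ct _ _ _ _ _ _ hz (p - 1)) as [_ b]; unfold zeta in b.
rewrite minus_INR in b by lia; simpl INR in b.
apply cube_le; [apply sqrt_pos |].
rewrite Rpow_mult_distr, s3.
assert (0 < PI * INR p) by (apply Rmult_lt_0_compat; lra).
lra.
Qed.

Lemma band_length_bound p : (1 <= p)%nat ->
  c p - ct (p - 1)%nat <= PI / 3 * (1 / scale_root (INR p)).
Proof.
intros hp; pose proof PI_bounds.
assert (h1 := INR_ge _ _ hp); simpl INR in h1.
destruct (scale_root_spec (INR p)) as [s s3]; [lra |].
assert (sl := sqrt_ct_lower p hp).
destruct (zl_ct _ _ _ _ _ _ hz (p - 1)) as [_ b]; destruct (zl_c _ _ _ _ _ _ hz p) as [b' _].
rewrite minus_INR in b by lia; simpl INR in b.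
destruct (zl_early _ _ _ _ _ _ hz (p - 1)) as [_ ce].
destruct (zl_lt _ _ _ _ _ _ hz (p - 1)) as [_ cl]; replace (S (p - 1)) with p in cl by lia.
destruct (zeta_diff (ct (p - 1)%nat) (c p)) as [_ d]; [lra | lra |].
eapply Rle_trans; [exact d |].
apply div_le; [lra |].
apply Rle_trans with (PI / 3 * (1 / scale_root (INR p)) * (1.3 * scale_root (INR p))).
- replace (PI / 3 * (1 / scale_root (INR p)) * (1.3 * scale_root (INR p))) with (PI / 3 * 1.3) by (field; lra).
  lra.
- apply Rmult_le_compat_l; auto.
  apply Rmult_le_pos; [lra | left; apply Rdiv_lt_0_compat; lra].
Qed.

Lemma gap_length_bound p : (2 <= p)%nat ->
  c (S p) - ct (p - 1)%nat <= PI * (1 / scale_root (INR p - 1)).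
Proof.
intros hp; pose proof PI_bounds.
assert (h1 := INR_ge _ _ hp); simpl INR in h1.
destruct (scale_root_spec (INR p)) as [s s3]; [lra |].
destruct (scale_root_spec (INR p - 1)) as [s' s3']; [lra |].
assert (sl := sqrt_ct_lower p ltac:(lia)).
assert (sl' : scale_root (INR p - 1) <= sqrt (ct (p - 1)%nat)).
{ apply Rle_trans with (scale_root (INR p)); [apply cube_le; [lra | rewrite s3, s3'; nra] | lra]. }
destruct (zl_ct _ _ _ _ _ _ hz (p - 1)) as [_ b]; destruct (zl_c _ _ _ _ _ _ hz (S p)) as [b' _].
rewrite minus_INR in b by lia; rewrite S_INR in b'; simpl INR in b.
destruct (zl_early _ _ _ _ _ _ hz (p - 1)) as [_ ce].
destruct (zl_lt _ _ _ _ _ _ hz (p - 1)) as [_ cl]; replace (S (p - 1)) with p in cl by lia.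
destruct (zl_lt _ _ _ _ _ _ hz p) as [cl1 cl2].
destruct (zeta_diff (ct (p - 1)%nat) (c (S p))) as [_ d]; [lra | lra |].
eapply Rle_trans; [exact d |].
apply div_le; [lra |].
apply Rle_trans with (PI * (1 / scale_root (INR p - 1)) * scale_root (INR p - 1)).
- replace (PI * (1 / scale_root (INR p - 1)) * scale_root (INR p - 1)) with PI by (field; lra).
  lra.
- apply Rmult_le_compat_l; auto.
  apply Rmult_le_pos; [lra | left; apply Rdiv_lt_0_compat; lra].
Qed.

(** The phase length [zeta (ct p) - zeta (c p)] is at least
    [PI / 4 - 0.453 > 0.24 * 1.36]; the factor [1.36] exceeds [(9/4)^(1/3)] by
    enough to absorb the shift of the zero already for [p = 2]. *)
Lemma gap_length_lower p : (2 <= p)%nat ->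
  0.24 / scale_root (INR p + 1) <= ct p - c p.
Proof.
intros hp; pose proof PI_bounds.
assert (h1 := INR_ge _ _ hp); simpl INR in h1.
destruct (scale_root_spec (INR p + 1)) as [s s3]; [lra |].
destruct (zl_ct _ _ _ _ _ _ hz p) as [b1 b2]; destruct (zl_c _ _ _ _ _ _ hz p) as [b3 _].
destruct (zl_early _ _ _ _ _ _ hz p) as [ce ce'].
destruct (zl_lt _ _ _ _ _ _ hz p) as [cl _].
assert (sq : 0 < sqrt (ct p)) by (apply sqrt_lt_R0; lra).
assert (sl : sqrt (ct p) <= 1.36 * scale_root (INR p + 1)).
{ apply cube_le; [lra |].
  rewrite Rpow_mult_distr, s3; unfold zeta in b1.
  assert (3.14 * (INR p + 1) <= PI * (INR p + 1)) by (apply Rmult_le_compat_r; lra).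
  lra. }
destruct (zeta_diff (c p) (ct p)) as [d _]; [lra | lra |].
eapply Rle_trans; [ | exact d].
apply le_div; auto.
apply Rle_trans with (0.24 / scale_root (INR p + 1) * (1.36 * scale_root (INR p + 1))).
- apply Rmult_le_compat_l; auto; left; apply Rdiv_lt_0_compat; lra.
- replace (0.24 / scale_root (INR p + 1) * (1.36 * scale_root (INR p + 1))) with (0.24 * 1.36) by (field; lra).
  lra.
Qed.

(** [4 / (3 PI) x ^ (3/2)] is [2 / PI * zeta x], which [zl_c] places in
    [(k, k + 1)] for [x = c k]. *)
Lemma int_part_position cc k : c k < cc < c (S k) ->
  Z.of_nat k = Int_part (4 / (3 * PI) * Rpower cc (3 / 2)) \/
  Z.of_nat k = (Int_part (4 / (3 * PI) * Rpower cc (3 / 2)) - 1)%Z.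
Proof.
intros hcc; pose proof PI_bounds.
destruct (zl_early _ _ _ _ _ _ hz k) as [hk _].
assert (e : 4 / (3 * PI) * Rpower cc (3 / 2) = 2 / PI * zeta cc).
{ unfold zeta; replace (3 / 2) with (/ 2 * INR 3) by (simpl; field).
  rewrite <- Rpower_mult, Rpower_sqrt, Rpower_pow by (try apply sqrt_lt_R0; lra).
  field; lra. }
rewrite e; clear e.
assert (mono : forall x y, 0 <= x -> x < y -> zeta x < zeta y).
{ intros x y hx hxy; unfold zeta.
  assert (sqrt x < sqrt y) by (apply sqrt_lt_1; lra).
  assert (0 <= sqrt x) by apply sqrt_pos.
  assert (sqrt x ^ 3 < sqrt y ^ 3); [ | lra].
  assert (0 < (sqrt y - sqrt x) * (sqrt x ^ 2 + sqrt x * sqrt y + sqrt y ^ 2)) by (apply Rmult_lt_0_compat; nra).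
  lra. }
assert (m1 := mono (c k) cc ltac:(lra) ltac:(lra)).
assert (m2 := mono cc (c (S k)) ltac:(lra) ltac:(lra)).
destruct (zl_c _ _ _ _ _ _ hz k) as [_ b1]; destruct (zl_c _ _ _ _ _ _ hz (S k)) as [b2 _].
rewrite S_INR in b2.
set (y := 2 / PI * zeta cc).
assert (hy : PI * y = 2 * zeta cc) by (unfold y; field; lra).
assert (y1 : INR k < y) by (apply Rmult_lt_reg_l with PI; lra).
assert (y2 : y < INR k + 2) by (apply Rmult_lt_reg_l with PI; lra).
rewrite INR_IZR_INZ in y1, y2.
destruct (Rlt_le_dec y (IZR (Z.of_nat k) + 1)) as [h | h].
- left; apply Int_part_spec; lra.
- right; rewrite <- (Int_part_spec y (Z.of_nat k + 1)); [lia |].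
  rewrite plus_IZR; lra.
Qed.
End Estimates.

Theorem theorem4
  (hbar m L0 V0 : R)
  (hhbar : 0 < hbar) (hm : 0 < m) (hL0 : 0 < L0) (hV0 : 0 < V0)
  (V : R -> R) (hV : periodic_potential L0 V0 V)
  (Emin Emax : nat -> R) (hE : band_edges hbar m L0 V Emin Emax)
  (u v : R -> R)
  (hu : airy_solution u 1 0) (hv : airy_solution v 0 1)
  (c ct : nat -> R)
  (hc_even : enumerates_decreasing (fun j => - c (2 * j)%nat)
               (fun x => Derive v x = 0))
  (hc_odd : enumerates_decreasing (fun j => - c (2 * j + 1)%nat)
              (fun x => x <> 0 /\ v x = 0))
  (hct_even : enumerates_decreasing (fun j => - ct (2 * j)%nat)
                (fun x => u x = 0))
  (hct_odd : enumerates_decreasing (fun j => - ct (2 * j + 1)%nat)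
               (fun x => x <> 0 /\ Derive u x = 0)) :
  let th := theta hbar m L0 V0 in
  let cc := th * V0 in
  let delta := band_width th Emin Emax in
  let gamma := gap_width th Emin Emax in
  c 0%nat < cc ->
  forall k0 : nat, position c ct cc k0 ->
  (forall k, position c ct cc k -> k = k0) /\
  (Z.of_nat k0 = Int_part (4 / (3 * PI) * Rpower cc (3 / 2)) \/
   Z.of_nat k0 = (Int_part (4 / (3 * PI) * Rpower cc (3 / 2)) - 1)%Z) /\
  (forall p, (p <= k0)%nat ->
     - cc <= th * Emin p /\ th * Emin p <= th * Emax p /\ th * Emax p <= 0) /\
  (forall p, (2 <= p <= k0)%nat ->
     0 < delta p <=
       (PI / 3 + 7 / (3 * PI) * ((INR p + 1 / 3) / (INR p * (INR p + 2 / 3))))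
       * Rpower (3 / PI) (1 / 3) * (1 / Rpower (INR p) (1 / 3))) /\
  (forall p, (2 <= p)%nat -> (p + 1 <= k0)%nat ->
     let lower := I_fun (Rpower (7 / 6) (2 / 3))
       * (Rpower 2 (1 / 3) * Rpower PI (2 / 3) / 9)
       * (1 / Rpower (INR p + 1) (1 / 3)) in
     0 < lower /\ lower < gamma p /\
     gamma p <=
       (PI + 7 / (3 * PI) * (INR p / (INR p ^ 2 - 1)))
       * Rpower (3 / PI) (1 / 3) * (1 / Rpower (INR p - 1) (1 / 3))) /\
  (forall p, - V0 <= Emax p -> Emin (S p) <= 0 ->
     exists E, spectral_gap Emin Emax p E).
Proof.
intros th cc delta gamma hc0 k0 hpos.
assert (hf : fundamental u (Derive u) v (Derive v)).
{ destruct (hu) as [_ [? ?]]; destruct (hv) as [_ [? ?]].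
  constructor; auto; eapply airy_solution_airy; eauto. }
assert (hz := zeros_location _ _ _ _ c ct hf hc_even hc_odd hct_even hct_odd).
pose proof PI_bounds as hpi.
assert (between : forall k, position c ct cc k -> c k < cc < c (S k)).
{ intros k hk; destruct (zl_lt _ _ _ _ _ _ hz k); unfold position in hk; lra. }
assert (hcc := between k0 hpos).
assert (located := fun p => band_edges_located _ _ _ _ c ct hf hz hbar m L0 V0 hhbar hm hL0 hV0 V hV k0 hcc Emin Emax hE p).
fold th in located; fold cc in located.
split; [ | split; [ | split; [ | split; [ | split]]]].
- intros k hk; apply between in hk.
  destruct (Nat.lt_total k k0) as [h | [h | h]]; auto; exfalso.
  + assert (h' := c_le _ _ _ _ _ _ hz (S k) k0 h); lra.
  + assert (h' := c_le _ _ _ _ _ _ hz (S k0) k h); lra.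
- eapply int_part_position; eauto.
- intros p hp; destruct (located p hp) as (l1 & l2 & l3).
  assert (l0 := prev_end_nonneg _ _ _ _ _ _ hz p).
  assert (l4 := c_le _ _ _ _ _ _ hz p k0 hp); lra.
- intros p [hp hpk]; destruct (located p hpk) as (l1 & l2 & l3).
  assert (h2 := le_INR _ _ hp); simpl INR in h2.
  unfold delta, band_width; split; [lra |].
  rewrite Rmult_assoc, scale_root_inv by lra.
  assert (b := band_length_bound _ _ _ _ _ _ hz p ltac:(lia)).
  destruct p as [ | p]; [lia |]; simpl prev_end in l1.
  replace (S p - 1)%nat with p in b by lia.
  set (n := INR (S p)) in *.
  assert (hs : 0 < 1 / scale_root n) by (apply Rdiv_lt_0_compat; [lra | apply scale_root_spec; lra]).
  assert (hx : 0 < 7 / (3 * PI) * ((n + 1 / 3) / (n * (n + 2 / 3)))).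
  { apply Rmult_lt_0_compat; apply Rdiv_lt_0_compat; try lra; apply Rmult_lt_0_compat; lra. }
  nra.
- intros p hp hpk lower.
  assert (h2 := le_INR _ _ hp); simpl INR in h2.
  destruct (located p ltac:(lia)) as (l1 & l2 & l3).
  destruct (located (S p) ltac:(lia)) as (l4 & l5 & l6).
  destruct (gap_lower_constant (INR p + 1)) as [lp lb]; [lra |]; fold lower in lp, lb.
  assert (b1 := gap_length_lower _ _ _ _ _ _ hz p hp).
  assert (b2 := gap_length_bound _ _ _ _ _ _ hz p hp).
  unfold gamma, gap_width; simpl prev_end in l4.
  split; [auto | split; [lra |]].
  rewrite Rmult_assoc, scale_root_inv by lra.
  destruct p as [ | p]; [lia |]; simpl prev_end in l1.
  replace (S p - 1)%nat with p in b2 by lia.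
  set (n := INR (S p)) in *.
  assert (hs : 0 < 1 / scale_root (n - 1)) by (apply Rdiv_lt_0_compat; [lra | apply scale_root_spec; lra]).
  assert (hx : 0 < 7 / (3 * PI) * (n / (n ^ 2 - 1))).
  { apply Rmult_lt_0_compat; apply Rdiv_lt_0_compat; try lra; nra. }
  nra.
- intros p _ h0.
  assert (h := gap_open _ _ _ _ c ct hf hz hbar m L0 V0 hhbar hm hL0 hV0 V hV k0 hcc Emin Emax hE p h0).
  exists ((Emax p + Emin (S p)) / 2); unfold spectral_gap; lra.
Qed.
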